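(* The map $\iota:\mathcal{K}(D^2)\to\mathcal{K}(\mathcal{A})$ induced by the inclusion of a disc $D^2$ in the annulus $\mathcal{A}$ is an injection. Moreover, there is a surjection $\rho$ of the set $\mathcal{K}(\mathcal{A})$ onto the set $\mathcal{K}(D^2)$, namely the map induced by the inclusion of the annulus in a disc.
   Context: For an oriented surface $\Sigma$, a multi-knotoid diagram in $\Sigma$ is a generic smooth immersion of one interval $[0,1]$ and finitely many (possibly zero) circles in the interior of $\Sigma$ whose only singularities are transversal double points (crossings) with over/under information; the images of $0$ and $1$ (leg and head) are distinct from each other and from the crossings. $\mathcal{K}(\Sigma)$ is the set of multi-knotoids in $\Sigma$: equivalence classes of such diagrams under surface isotopies of $\Sigma$ and Reidemeister moves R1, R2, R3 performed away from the endpoints (moving a strand over or under an endpoint is forbidden). $\mathcal{A}=S^1\times D^1$ is the annulus. The disc $D^2$ is included in $\mathcal{A}$ as an embedded disc in its interior, and $\mathcal{A}$ is included in a disc as a disc with a central hole. An inclusion of surfaces lets diagrams in the smaller surface be viewed as diagrams in the larger one, inducing a map of equivalence classes. *)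

(* Defs.v *)
From HB Require Import structures.
From Stdlib Require Import Relation_Operators.
From mathcomp Require Import all_boot all_order all_algebra.
From mathcomp Require Import all_classical all_reals all_analysis.

Set Implicit Arguments.
Unset Strict Implicit.
Unset Printing Implicit Defensive.

Import Order.TTheory GRing.Theory Num.Theory.
Import numFieldNormedType.Exports.

Local Open Scope classical_set_scope.
Local Open Scope ring_scope.

Section Smooth.
Context {R : realType}.

(* [f] is of class C^k on the open set [U]. *)
Fixpoint class_C (k : nat) (V W : normedModType R) (U : set V) (f : V -> W)
    : Prop :=
  if k is k'.+1 then
    (forall x, U x -> differentiable f x) /\
    (forall v : V, class_C k' U (fun x => 'D_v f x))
  else forall x, U x -> {for x, continuous f}.

Definition smooth_on (V W : normedModType R) (U : set V) (f : V -> W) : Prop :=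
  forall k, class_C k U f.

(* Smoothness on an arbitrary (in practice closed) set [X] means smoothness on
   some open neighbourhood of [X]; the values of [f] off [X] are irrelevant. *)
Definition smooth_near (V W : normedModType R) (X : set V) (f : V -> W)
    : Prop :=
  exists U : set V, [/\ open U, X `<=` U & smooth_on U f].

End Smooth.

Notation plane R := (R * R)%type.

Section PlanarSurfaces.
Context {R : realType}.

Implicit Types (X S : set (plane R)) (f : plane R -> plane R).

Definition sqnorm (x : plane R) : R := x.1 ^+ 2 + x.2 ^+ 2.

Definition det2 (u v : plane R) : R := u.1 * v.2 - u.2 * v.1.

Definition disc : set (plane R) := [set x | sqnorm x <= 1].

(* The annulus S^1 x D^1, realised as the disc with a central hole of
   radius [r], for 0 < r < 1. *)
Definition annulus (r : R) : set (plane R) :=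
  [set x | r ^+ 2 <= sqnorm x <= 1].

(* [f] restricts to a smooth embedding of the planar surface [X]: it is a
   diffeomorphism from an open neighbourhood of [X] onto an open set. *)
Definition embedding X f : Prop :=
  exists (U : set (plane R)) (g : plane R -> plane R),
    [/\ open U /\ X `<=` U, open (f @` U),
        smooth_on U f, smooth_on (f @` U) g &
        forall x, U x -> g (f x) = x].

Definition plane_diffeo f : Prop :=
  exists g, [/\ smooth_on setT f, smooth_on setT g, cancel f g & cancel g f].

(* Isotopies of the surface [S] are supported in a compact subset of its
   interior, and are extended to the plane by the identity. *)
Definition surface_isotopy S (H : R -> plane R -> plane R) : Prop :=
  [/\ smooth_near [set p : R * plane R | 0 <= p.1 <= 1]
                  (fun p : R * plane R => H p.1 p.2),
      forall x, H 0 x = x,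
      forall t, 0 <= t <= 1 -> plane_diffeo (H t) &
      exists K : set (plane R), [/\ compact K, K `<=` S° &
        forall t x, 0 <= t <= 1 -> ~ K x -> H t x = x]].

End PlanarSurfaces.

Section Diagrams.
Context {R : realType}.

(* [None] is the interval, [Some i] the i-th circle.  A circle is R/Z, so that
   a map from it is a 1-periodic map on R; the interval is [0,1]. *)
Definition component (n : nat) := option 'I_n.
Definition pt (n : nat) := (component n * R)%type.

Definition dom (n : nat) (c : component n) : set R :=
  if c is Some _ then setT else [set t | 0 <= t <= 1].

Definition in_source (n : nat) (p : pt n) : Prop := dom p.1 p.2.

Definition same_pt (n : nat) (p q : pt n) : Prop :=
  p.1 = q.1 /\
  if p.1 is Some _ then exists k : int, p.2 = q.2 + k%:~R else p.2 = q.2.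

Definition strands (n : nat) := component n -> R -> plane R.
Definition crossing_info (n : nat) := rel (pt n).

(* Diagram data; [over p q] is only meaningful when [p] and [q] are the two
   preimages of a crossing, and says that the strand through [p] is above. *)
Record diagram := Diagram {
  ncircles : nat;
  strand : strands ncircles;
  over : crossing_info ncircles }.

Arguments strand : clear implicits.
Arguments over : clear implicits.

Definition at_pt (n : nat) (s : strands n) (p : pt n) : plane R := s p.1 p.2.

Definition velocity (n : nat) (s : strands n) (p : pt n) : plane R :=
  derive1 (s p.1) p.2.

Definition double_pt (n : nat) (s : strands n) (p q : pt n) : Prop :=
  [/\ in_source p, in_source q, ~ same_pt p q & at_pt s p = at_pt s q].

Definition generic_immersion (S : set (plane R)) (n : nat) (s : strands n)
    : Prop :=
  [/\ forall c, smooth_near (dom c) (s c),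
      forall i t, s (Some i) (t + 1) = s (Some i) t,
      forall p, in_source p -> S° (at_pt s p) &
      forall p, in_source p -> velocity s p != 0] /\
  [/\ forall p q, double_pt s p q -> det2 (velocity s p) (velocity s q) != 0,
      forall p q u, double_pt s p q -> double_pt s q u -> same_pt p u,
      forall p, in_source p -> s None 0 = at_pt s p -> same_pt (None, 0) p &
      forall p, in_source p -> s None 1 = at_pt s p -> same_pt (None, 1) p].

Definition valid_crossing_info (n : nat) (s : strands n) (o : crossing_info n)
    : Prop :=
  (forall p q, double_pt s p q -> o p q = ~~ o q p) /\
  (forall p q p' q', double_pt s p q -> same_pt p p' -> same_pt q q' ->
     o p q = o p' q').

Definition is_diagram (S : set (plane R)) (D : diagram) : Prop :=
  generic_immersion S (strand D) /\ valid_crossing_info (strand D) (over D).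

Definition push (f : plane R -> plane R) (D : diagram) : diagram :=
  Diagram (fun c t => f (strand D c t)) (over D).

(* [D] and [D'] are the same diagram up to a diffeomorphism of the source
   preserving leg and head.  The circles are unordered and unoriented. *)
Definition reparametrization (D D' : diagram) : Prop :=
  exists (sigma : component (ncircles D) -> component (ncircles D'))
         (theta : component (ncircles D) -> R -> R),
    let tau p := (sigma p.1, theta p.1 p.2) in
    [/\ bijective sigma, sigma None = None,
        forall c, smooth_near (dom c) (theta c) &
        forall p, in_source p -> derive1 (theta p.1) p.2 != 0] /\
    [/\ theta None 0 = 0 /\ theta None 1 = 1,
        forall i, exists2 e : R, e = 1 \/ e = - 1 &
          forall t, theta (Some i) (t + 1) = theta (Some i) t + e,
        forall p, in_source p -> at_pt (strand D') (tau p) =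
                                 at_pt (strand D) p &
        forall p q, double_pt (strand D) p q ->
          over D' (tau p) (tau q) = over D p q].

Definition isotopic (S : set (plane R)) (D D' : diagram) : Prop :=
  exists2 H, surface_isotopy S H & D' = push (H 1) D.

Section Reidemeister.
Context {n : nat}.

Record subarc := Subarc { scomp : component n; sbeg : R; send : R }.

Implicit Types (a b c : subarc) (s : strands n) (o : crossing_info n).

Definition proper_subarc a : Prop :=
  sbeg a < send a /\
  if scomp a is Some _ then send a < sbeg a + 1
  else 0 < sbeg a /\ send a < 1.

Definition cl_par a : set R := [set t | sbeg a <= t <= send a].
Definition op_par a : set R := [set t | sbeg a < t < send a].

Definition cl_pts (A : set subarc) : set (pt n) :=
  [set p | exists a t, [/\ A a, cl_par a t & same_pt p (scomp a, t)]].
Definition op_pts (A : set subarc) : set (pt n) :=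
  [set p | exists a t, [/\ A a, op_par a t & same_pt p (scomp a, t)]].

Definition along s a (t : R) : plane R := s (scomp a) t.

(* The part of [s] lying in the closed disc [B] consists of the subarcs in
   [A], which meet the boundary of [B] exactly in their endpoints.  Since
   proper subarcs of the interval avoid 0 and 1, leg and head are off [B]. *)
Definition tangle_in (B : set (plane R)) (A : set subarc) s : Prop :=
  forall p, in_source p ->
    (B (at_pt s p) <-> cl_pts A p) /\ (B° (at_pt s p) <-> op_pts A p).

Definition local_move (S : set (plane R)) (A : set subarc) s o s' o' : Prop :=
  (forall a, A a -> proper_subarc a) /\
  exists2 phi : plane R -> plane R,
    embedding disc phi /\ phi @` disc `<=` S° &
    [/\ tangle_in (phi @` disc) A s, tangle_in (phi @` disc) A s',
        forall p, in_source p -> ~ op_pts A p -> at_pt s' p = at_pt s p &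
        forall p q, double_pt s p q -> ~ cl_pts A p -> ~ cl_pts A q ->
          o' p q = o p q].

Definition simple_on s a : Prop :=
  forall t u, cl_par a t -> cl_par a u -> along s a t = along s a u -> t = u.

Definition R1 (S : set (plane R)) s o s' o' : Prop :=
  exists a, [/\ local_move S [set a] s o s' o', simple_on s' a &
    exists t u, [/\ op_par a t, op_par a u, t < u, along s a t = along s a u &
      forall t' u', cl_par a t' -> cl_par a u' -> t' < u' ->
        along s a t' = along s a u' -> t' = t /\ u' = u]].

Definition R2 (S : set (plane R)) s o s' o' : Prop :=
  exists a b, [/\ local_move S [set a; b] s o s' o',
    [/\ simple_on s a, simple_on s b, simple_on s' a & simple_on s' b],
    forall t u, cl_par a t -> cl_par b u -> along s' a t <> along s' b u &
    exists t1 u1 t2 u2,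
      [/\ t1 < t2 /\ u1 != u2,
          [/\ op_par a t1, op_par b u1 & along s a t1 = along s b u1],
          [/\ op_par a t2, op_par b u2 & along s a t2 = along s b u2],
          forall t u, cl_par a t -> cl_par b u -> along s a t = along s b u ->
            (t = t1 /\ u = u1) \/ (t = t2 /\ u = u2) &
          o (scomp a, t1) (scomp b, u1) /\ o (scomp a, t2) (scomp b, u2)]].

(* [a] and [b] cross exactly once, at parameters [t] and [u], [a] above. *)
Definition crosses_over_once s o a b (t u : R) : Prop :=
  [/\ op_par a t, op_par b u, along s a t = along s b u,
      o (scomp a, t) (scomp b, u) &
      forall t' u', cl_par a t' -> cl_par b u' -> along s a t' = along s b u' ->
        t' = t /\ u' = u].

(* [a], [b], [c] are the top, middle and bottom strands; along each of them
   the order of its two crossings is reversed by the move. *)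
Definition R3 (S : set (plane R)) s o s' o' : Prop :=
  exists a b c, [/\ local_move S [set a; b; c] s o s' o',
    [/\ simple_on s a, simple_on s b & simple_on s c],
    [/\ simple_on s' a, simple_on s' b & simple_on s' c] &
    exists ab ba ac ca bc cb ab' ba' ac' ca' bc' cb' : R,
      [/\ [/\ crosses_over_once s o a b ab ba,
              crosses_over_once s o a c ac ca &
              crosses_over_once s o b c bc cb],
          [/\ crosses_over_once s' o' a b ab' ba',
              crosses_over_once s' o' a c ac' ca' &
              crosses_over_once s' o' b c bc' cb'] &
          [/\ (ab < ac) = (ac' < ab'), (ba < bc) = (bc' < ba') &
              (ca < cb) = (cb' < ca')]]].

End Reidemeister.

Definition reidemeister (S : set (plane R)) (D D' : diagram) : Prop :=
  exists n (s s' : strands n) (o o' : crossing_info n),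
    [/\ D = Diagram s o, D' = Diagram s' o' &
        [\/ R1 S s o s' o', R2 S s o s' o' | R3 S s o s' o']].

Definition elementary_move (S : set (plane R)) (D D' : diagram) : Prop :=
  [/\ is_diagram S D, is_diagram S D' &
      [\/ reparametrization D D', isotopic S D D' | reidemeister S D D']].

Definition equivalent (S : set (plane R)) : diagram -> diagram -> Prop :=
  clos_refl_sym_trans diagram (elementary_move S).

Definition multi_knotoid (S : set (plane R)) (D : diagram) : set diagram :=
  [set E | equivalent S D E].

(* The set K(S) of multi-knotoids in [S], as a set of equivalence classes. *)
Definition multi_knotoids (S : set (plane R)) : set (set diagram) :=
  [set multi_knotoid S D | D in is_diagram S].

(* The map K(S) -> K(T) induced by an embedding [f] of [S] into [T]: the class
   of [D] is sent to the class in [T] of [push f D].  As a union over the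
   representatives [D], its value lies in K(T) only if the class of [push f D]
   does not depend on [D]. *)
Definition induced_map (T : set (plane R)) (f : plane R -> plane R)
    (C : set diagram) : set diagram :=
  \bigcup_(D in C) multi_knotoid T (push f D).

End Diagrams.

(* Main.v *)
Require Import Defs.
From HB Require Import structures.
From Stdlib Require Import Relation_Operators.
From mathcomp Require Import all_boot all_order all_algebra.
From mathcomp Require Import all_classical all_reals all_analysis.
From mathcomp Require Import lra.
Import Order.TTheory GRing.Theory Num.Theory.
Import numFieldNormedType.Exports.
Local Open Scope classical_set_scope.
Local Open Scope ring_scope.
Set Implicit Arguments.
Unset Strict Implicit.

(* Let [e] embed the disc in the annulus.  Pushing diagrams forward along an
   embedding respects equivalence: Reidemeister moves and reparametrizations
   transfer directly, and a compactly supported isotopy is conjugated by the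
   embedding and extended by the identity.

   Injectivity avoids the disc theorem.  If [push e D] and [push e E] are
   equivalent in the annulus, they are so in the disc.  Let [B] be a round ball
   about [e 0] inside [e (disc)], let [c] be a contraction towards [e 0] mapping
   the disc into [B], and let [M := e^-1 o c].  Then [push M] is a left inverse
   of [push e] on classes: first shrink [D] radially so that [push e D] lies in
   [B]; there [c] is the end of a radial isotopy supported in [B], which [e^-1]
   carries to an isotopy of the disc from [D] to [push M (push e D)].

   Surjectivity: in the disc, a diagram can be shrunk and then moved off the
   hole by undoing a contraction about a point near the centre.

   The radial isotopies are [x |-> m(|x|^2) x] with [m] nondecreasing, so their
   inverses come from the one-variable inverse function theorem. *)

(** * Calculus of class C^k *)

Section ClassC.
Context {R : realType}.
Implicit Types V W Z : normedModType R.

Lemma class_C_sub k V W (U U' : set V) (f : V -> W) :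
  U' `<=` U -> class_C k U f -> class_C k U' f.
Proof.
elim: k f => [|k IH] f sU /= => [h x /sU /h //|[h1 h2]]; split=> [x /sU /h1 //|v].
exact: IH.
Qed.

(** Lets smoothness be checked separately on the open pieces of a cover; [smooth_conj_chart] rests
    on it. *)
Lemma class_C_cover k V W (U : set V) (f : V -> W) :
  (forall x, U x -> exists2 U', U' x & class_C k U' f) -> class_C k U f.
Proof.
elim: k f => [|k IH] f /= h.
  by move=> x /[dup] Ux /h [U' U'x]; exact.
split=> [x /h [U' U'x [+ _]]|v]; first exact.
by apply: IH => x /h [U' U'x [_ /(_ v) ?]]; exists U'.
Qed.

(** The first-order expansion of [f] at [x] is also one for [g], and uniqueness of the differential
    identifies its linear part with that of [g]. *)
Lemma near_eq_differentiable V W (f g : V -> W) x :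
  {near x, f =1 g} -> differentiable f x -> differentiable g x.
Proof.
move=> fg /diff_locallyP[cd ef].
have fgx : f x = g x := nbhs_singleton fg.
suff eg : g \o shift x = cst (g x) + 'd f x +o_ 0 id.
  apply/diff_locallyP; split; last by rewrite (diff_unique cd eg).
  by rewrite (diff_unique cd eg).
apply/eqaddoP => e e0; move/eqaddoP : ef => /(_ e e0).
have : \forall h \near 0, f (h + x) = g (h + x).
  by move: fg; rewrite (near_shift 0 x) subr0.
apply: filterS2 => h /= fgh; rewrite /= !fctE /= -fgx -fgh; exact.
Qed.

(** As [U] is open, agreement on [U] is agreement near each of its points, hence passes to
    derivatives. The differentiation rules below hold only on [U] and enter the inductions through
    this lemma. *)
Lemma class_C_eq k V W (U : set V) (f g : V -> W) :
  open U -> {in U, f =1 g} -> class_C k U f -> class_C k U g.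
Proof.
move=> oU; elim: k f g => [|k IH] f g fg.
  move=> /= cf x Ux.
  have nfg : {near x, f =1 g}.
    by apply: filterS (open_nbhs_nbhs (conj oU Ux)) => y Uy; apply/fg/mem_set.
  have -> : {for x, continuous g} = (g @ x --> f x).
    by rewrite (nbhs_singleton nfg).
  by apply: cvg_trans (cf x Ux); exact: near_eq_cvg.
have nfg x : U x -> {near x, f =1 g}.
  by move=> Ux; apply: filterS (open_nbhs_nbhs (conj oU Ux)) => y Uy;
    apply/fg/mem_set.
move=> /= [df Df]; split=> [x Ux|v].
  exact: near_eq_differentiable (nfg _ Ux) (df _ Ux).
apply: IH (Df v) => x /set_mem Ux; exact: near_eq_derive (nfg x Ux).
Qed.

Lemma class_CS k V W (U : set V) (f : V -> W) :
  class_C k.+1 U f -> class_C k U f.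
Proof.
elim: k f => [|k IH] f [df Df].
  by move=> x Ux; apply: differentiable_continuous (df x Ux).
by split=> // v; apply: IH.
Qed.

Lemma class_C_cst k V W (U : set V) (w : W) : class_C k U (fun=> w).
Proof.
elim: k w => [|k IH] w /=; first by move=> x _; exact: cst_continuous.
split=> [x _|v]; first exact: differentiable_cst.
by under eq_fun do rewrite derive_cst; exact: IH.
Qed.

Lemma class_CD k V W (U : set V) (f g : V -> W) : open U ->
  class_C k U f -> class_C k U g -> class_C k U (fun x => f x + g x).
Proof.
move=> oU; elim: k f g => [|k IH] f g.
  by move=> /= cf cg x Ux; apply: continuousD; [exact: cf|exact: cg].
move=> [df Df] [dg Dg]; split=> [x Ux|v].
  by apply: differentiableD; [exact: df|exact: dg].
apply: class_C_eq (IH _ _ (Df v) (Dg v)) => // x /set_mem Ux.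
by rewrite -deriveD//; apply: diff_derivable; [exact: df|exact: dg].
Qed.

Lemma class_CM k V (U : set V) (f g : V -> R) : open U ->
  class_C k U f -> class_C k U g -> class_C k U (fun x => f x * g x).
Proof.
move=> oU; elim: k f g => [|k IH] f g.
  by move=> /= cf cg x Ux; apply: continuousM; [exact: cf|exact: cg].
move=> /[dup] /class_CS Cf [df Df] /[dup] /class_CS Cg [dg Dg].
split=> [x Ux|v].
  by apply: differentiableM; [exact: df|exact: dg].
have := class_CD oU (IH _ _ Cf (Dg v)) (IH _ _ Cg (Df v)).
apply: class_C_eq => // x /set_mem Ux.
by rewrite -deriveM//; apply: diff_derivable; [exact: df|exact: dg].
Qed.

Lemma class_C_sum k V W (U : set V) I (s : seq I) (F : I -> V -> W) : open U ->
  (forall i, class_C k U (F i)) -> class_C k U (fun x => \sum_(i <- s) F i x).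
Proof.
move=> oU CF; elim: s => [|i s IH].
  by under eq_fun do rewrite big_nil; exact: class_C_cst.
by under eq_fun do rewrite big_cons; exact: class_CD.
Qed.

Lemma class_C_linear k V W Z (U : set V) (f : V -> W) (l : {linear W -> Z}) :
  open U -> continuous l -> class_C k U f -> class_C k U (fun x => l (f x)).
Proof.
move=> oU cl; elim: k f => [|k IH] f.
  by move=> /= cf x Ux; apply: continuous_comp; [exact: cf|exact: cl].
have dl w : differentiable l w by exact: linear_differentiable.
move=> [df Df]; split=> [x Ux|v].
  by apply: differentiable_comp => //; exact: df.
apply: class_C_eq (IH _ (Df v)) => // x /set_mem Ux.
have dfx := df x Ux.
rewrite !deriveE//; last exact: differentiable_comp.
have dlfx : differentiable l (f x) by exact: dl.
by rewrite (diff_comp dfx dlfx) (diff_lin _ cl).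
Qed.

Lemma class_C_pair k V W Z (U : set V) (f : V -> W) (g : V -> Z) : open U ->
  class_C k U f -> class_C k U g -> class_C k U (fun x => (f x, g x)).
Proof.
move=> oU; elim: k f g => [|k IH] f g.
  by move=> /= cf cg x Ux; apply: cvg_pair; [exact: cf|exact: cg].
move=> [df Df] [dg Dg]; split=> [x Ux|v].
  by apply: differentiable_pair; [exact: df|exact: dg].
apply: class_C_eq (IH _ _ (Df v) (Dg v)) => // x /set_mem Ux.
have [dfx dgx] := (df x Ux, dg x Ux).
rewrite !deriveE//; last exact: differentiable_pair.
by rewrite diff_pair.
Qed.

Lemma class_C_id k V (U : set V) : class_C k U (id : V -> V).
Proof.
case: k => [|k]; first by move=> x _; exact: cvg_id.
split=> [x _|v]; first by [].
by under eq_fun do rewrite derive_id; exact: class_C_cst.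
Qed.

(* Finitely many continuous coordinates, which is what the chain rule for
   directional derivatives needs of the intermediate space. *)
Definition has_coordinates W : Prop :=
  exists (I : finType) (b : I -> W) (l : I -> {linear W -> R^o}),
    (forall i, continuous (l i)) /\ forall w, w = \sum_i l i w *: b i.

Lemma has_coordinates_R : has_coordinates R.
Proof.
exists unit, (fun=> 1), (fun=> idfun); split=> [_ ?|w]; first exact: cvg_id.
by rewrite big_const card_unit /= addr0 /GRing.scale /= mulr1.
Qed.

Lemma has_coordinates_prod V W :
  has_coordinates V -> has_coordinates W -> has_coordinates (V * W)%type.
Proof.
move=> [I [b [l [cl lE]]]] [J [b' [l' [cl' lE']]]].
exists (I + J)%type.
exists (fun k => match k with inl i => (b i, 0) | inr j => (0, b' j) end).
exists (fun k => match k return {linear (V * W)%type -> R^o} with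
  inl i => l i \o @fst V W | inr j => l' j \o @snd V W end).
split=> [[i|j] x|[v w]].
- by apply: continuous_comp; [exact: cvg_fst|exact: cl].
- by apply: continuous_comp; [exact: cvg_snd|exact: cl'].
have addE (a c : V) (a' c' : W) : (a, a') + (c, c') = (a + c, a' + c') by [].
have scaleE r (a : V) (a' : W) : r *: (a, a') = (r *: a, r *: a') by [].
rewrite big_sumType/=.
transitivity ((\sum_i l i v *: b i, 0) + (0, \sum_j l' j w *: b' j) : V * W).
  by rewrite -lE -lE' addE addr0 add0r.
congr (_ + _).
  apply: (big_ind2 (fun (x : V) (y : V * W) => (x, 0) = y)) => //.
    by move=> x1 x2 y1 y2 <- <-; rewrite addE addr0.
  by move=> i _; rewrite scaleE scaler0.
apply: (big_ind2 (fun (x : W) (y : V * W) => (0, x) = y)) => //.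
  by move=> x1 x2 y1 y2 <- <-; rewrite addE addr0.
by move=> i _; rewrite scaleE scaler0.
Qed.

Lemma class_CZl k V W (U : set V) (f : V -> R) (w : W) : open U ->
  class_C k U f -> class_C k U (fun x => f x *: w).
Proof.
move=> oU; elim: k f => [|k IH] f.
  by move=> cf x Ux; apply: continuousZr_tmp; exact: cf.
move=> [df Df]; split=> [x Ux|v].
  by apply: differentiableZl; exact: df.
apply: class_C_eq (IH _ (Df v)) => // x /set_mem Ux.
have dfx := df x Ux.
rewrite !deriveE//; last exact: differentiableZl.
by rewrite diffZl.
Qed.

Lemma derive_comp V W Z (f : V -> W) (g : W -> Z) x v :
  differentiable f x -> differentiable g (f x) ->
  'D_v (fun y => g (f y)) x = 'd g (f x) ('D_v f x).
Proof.
move=> df dg; have dgf := differentiable_comp df dg.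
by rewrite !deriveE// (diff_comp df dg).
Qed.

(** The induction hypothesis concerns derivatives of [g] in fixed directions, whereas the chain rule
    differentiates [g] in the direction ['D_v f x], which moves with [x]. Coordinates expand the
    latter into the fixed directions [b i]. *)
Lemma class_C_comp_R k V W (U : set V) (U' : set W) (f : V -> W) (g : W -> R) :
  has_coordinates W -> open U -> open U' -> (forall x, U x -> U' (f x)) ->
  class_C k U f -> class_C k U' g -> class_C k U (fun x => g (f x)).
Proof.
move=> [I [b [l [cl lE]]]] oU oU' fU; elim: k f g fU => [|k IH] f g fU.
  move=> cf cg x Ux; apply: continuous_comp; first exact: cf.
  exact/cg/fU.
move=> /[dup] /class_CS Cf [df Df] [dg dg_].
split=> [x Ux|v].
  by apply: differentiable_comp; [exact: df|exact/dg/fU].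
have C : class_C k U (fun x => \sum_i (l i ('D_v f x) : R) * 'D_(b i) g (f x)).
  apply: class_C_sum => // i; apply: class_CM => //.
    exact: (@class_C_linear _ _ _ R^o _ _ (l i) oU (cl i) (Df v)).
  exact: IH fU Cf (dg_ (b i)).
apply: class_C_eq C => // x /set_mem Ux.
have [dfx dgx] := (df x Ux, dg _ (fU x Ux)).
rewrite (derive_comp v dfx dgx) [in RHS](lE ('D_v f x)) linear_sum.
by apply: eq_bigr => i _; rewrite linearZ/= (deriveE _ dgx).
Qed.

Lemma class_C_comp k V W Z (U : set V) (U' : set W) (f : V -> W) (g : W -> Z) :
  has_coordinates W -> has_coordinates Z ->
  open U -> open U' -> (forall x, U x -> U' (f x)) ->
  class_C k U f -> class_C k U' g -> class_C k U (fun x => g (f x)).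
Proof.
move=> hW [I [b [l [cl lE]]]] oU oU' fU Cf Cg.
under eq_fun do rewrite [g _]lE.
apply: class_C_sum => // i; apply: class_CZl => //.
apply: (@class_C_comp_R _ _ _ _ U' f (fun y => l i (g y))) => //.
exact: (@class_C_linear _ _ _ R^o _ _ (l i) oU' (cl i) Cg).
Qed.

(** The derivative of [1/f] is [- (1/f)^2] times that of [f], and [1/f] is already of class C^k by
    induction. *)
Lemma class_CV k V (U : set V) (f : V -> R) : open U ->
  (forall x, U x -> f x != 0) ->
  class_C k U f -> class_C k U (fun x => (f x)^-1).
Proof.
move=> oU f0; elim: k => [|k IH].
  by move=> cf x Ux; apply: continuousV; [exact: f0|exact: cf].
move=> /[dup] /class_CS/IH CVf [df Df]; split=> [x Ux|v].
  by apply: differentiableV; [exact: df|exact: f0].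
have C : class_C k U (fun x => -1 * ((f x)^-1 * (f x)^-1) * 'D_v f x).
  apply: (class_CM oU _ (Df v)); apply: (class_CM oU (class_C_cst _ _ _)).
  exact: class_CM.
apply: class_C_eq C => // x /set_mem Ux.
rewrite deriveV; [|exact: f0|exact/diff_derivable/df].
by rewrite mulN1r -invfM -expr2.
Qed.

Lemma class_CZ k V Z (U : set V) (c : V -> R) (f : V -> Z) :
  has_coordinates Z -> open U ->
  class_C k U c -> class_C k U f -> class_C k U (fun x => c x *: f x).
Proof.
move=> [I [b [l [cl lE]]]] oU Cc Cf.
under eq_fun do rewrite [f _]lE scaler_sumr.
apply: class_C_sum => // i; under eq_fun do rewrite scalerA.
apply: class_CZl => //; apply: class_CM => //.
exact: (@class_C_linear _ _ _ R^o _ _ (l i) oU (cl i) Cf).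
Qed.

Lemma class_C_fst k V W Z (U : set V) (f : V -> W * Z) : open U ->
  class_C k U f -> class_C k U (fun x => (f x).1).
Proof.
move=> oU; apply: (class_C_linear (l := @fst W Z)) => // x; exact: cvg_fst.
Qed.

Lemma class_C_snd k V W Z (U : set V) (f : V -> W * Z) : open U ->
  class_C k U f -> class_C k U (fun x => (f x).2).
Proof.
move=> oU; apply: (class_C_linear (l := @snd W Z)) => // x; exact: cvg_snd.
Qed.

End ClassC.

(** * A smooth step *)

Section Bump.
Context {R : realType}.
Implicit Types (x y s : R).

(** The functions x^(-n) exp(-1/x), extended by 0. Taking all [n] together gives a family whose
    derivatives are combinations of its own members. *)
Definition flat (n : nat) x : R := if 0 < x then x^-1 ^+ n * expR (- x^-1) else 0.

Lemma flat_ge0 n x : 0 <= flat n x.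
Proof.
by rewrite /flat; case: ifP => // x0; rewrite mulr_ge0 ?expR_ge0// exprn_ge0// invr_ge0 ltW.
Qed.

Lemma flat0_gt0 x : 0 < x -> 0 < flat 0 x.
Proof. by move=> x0; rewrite /flat x0 mul1r expR_gt0. Qed.

Lemma flat_le0 n x : x <= 0 -> flat n x = 0.
Proof. by move=> x0; rewrite /flat ltNge x0. Qed.

(** Comes from exp(u) >= u^(n+1)/(n+1)! at u = 1/x. It gives continuity of the whole family at 0. *)
Lemma flat_bound n x : `|flat n x| <= n.+1`!%:R * `|x|.
Proof.
rewrite ger0_norm ?flat_ge0// /flat; case: ifPn => [x0|_]; last by rewrite mulr_ge0.
rewrite gtr0_norm// expRN ler_pdivrMr ?expR_gt0//.
have u0 : 0 < x^-1 by rewrite invr_gt0.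
have := expR_ge1Dxn n (ltW u0).
set e := expR _ => h.
have {h} : x^-1 ^+ n.+1 / n.+1`!%:R <= e by apply: le_trans h; rewrite lerDr.
rewrite ler_pdivrMr ?ltr0n ?fact_gt0// exprSr ler_pdivrMr// => /le_trans; apply.
by rewrite -mulrA mulrC.
Qed.

Lemma flatS n x : x^-1 * flat n x = flat n.+1 x.
Proof. by rewrite /flat; case: ifP => _; rewrite ?mulr0// exprS mulrA. Qed.

Lemma is_derive_flat n x :
  is_derive x 1 (flat n) (- n%:R * flat n.+1 x + flat n.+2 x).
Proof.
have [x0|x0|->] := ltgtP x 0.
- rewrite !(flat_le0 _ (ltW x0)) mulr0 addr0.
  apply: (@near_eq_is_derive _ _ _ (cst 0)).
  by near=> y; rewrite flat_le0//; near: y; exact: lt_le_nbhsl.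
- apply: (@near_eq_is_derive _ _ _ (fun y => y^-1 ^+ n * expR (- y^-1))).
    by near=> y; rewrite /flat ifT//; near: y; exact: lt_nbhsr.
  have xn0 : x != 0 by rewrite gt_eqF.
  have dV : is_derive x 1 (fun y : R => y^-1) (- x ^- 2).
    by rewrite -[- _]mulr1; exact: is_deriveV.
  have dE : is_derive x 1 (fun y => expR (- y^-1)) (expR (- x^-1) * x ^- 2).
    have dN : is_derive x 1 (fun y : R => - y^-1) (x ^- 2).
      by rewrite -[x ^- 2]opprK; exact: is_deriveN.
    exact: (@is_derive1_comp _ expR (fun y : R => - y^-1)).
  have := is_deriveX n dV; rewrite exprfctE => dX.
  apply: is_derive_eq (is_deriveM dX dE) _.
  rewrite /flat x0 /GRing.scale /= -!exprVn.
  case: n {dX} => [|n].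
  by rewrite ?(mul0r, mulr0, oppr0, addr0, add0r, expr0, mul1r) mulrC.
  by rewrite !exprS /=; lra.
(* At 0 the difference quotient of [flat n] is [flat n.+1] itself, so its continuity at 0, from
   [flat_bound], makes the derivative 0. *)
rewrite !flat_le0// mulr0 addr0; apply/is_derive1_caratheodory.
exists (flat n.+1); split; last exact: flat_le0.
- move=> z; rewrite (flat_le0 _ (lexx 0)) !subr0 -flatS mulrAC.
  have [z0|z0] := leP z 0; first by rewrite flat_le0// mulr0.
  by rewrite mulVf ?gt_eqF// mul1r.
- apply/cvgrPdist_lt => eps eps0; near=> y.
  rewrite flat_le0// sub0r normrN (le_lt_trans (flat_bound _ _))//.
  rewrite mulrC -ltr_pdivlMr ?ltr0n ?fact_gt0//.
  near: y; exists (eps / n.+2`!%:R) => /=; last by move=> z /=; rewrite sub0r normrN.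
  by rewrite divr_gt0 ?ltr0n ?fact_gt0.
Unshelve. all: by end_near.
Qed.

(** On the line the derivative in direction [v] is [v] times the derivative in direction 1. *)
Lemma is_derive_class_C k (f f' : R -> R) :
  (forall x, is_derive x 1 f (f' x)) -> class_C k setT f' -> class_C k.+1 setT f.
Proof.
move=> ff' Cf'; have df x : differentiable f x by apply/derivable1_diffP.
split=> // v; have := class_CM openT (class_C_cst k _ v) Cf'.
apply: class_C_eq openT _ => x _.
rewrite deriveE// -[v in 'd f x v]mulr1 -[v * 1]/(v *: 1) linearZ/= -deriveE//.
by rewrite derive_val.
Qed.

(** The induction on [k] treats all [n] at once, because differentiating raises the index by one and
    by two. *)
Lemma smooth_flat n : smooth_on setT (flat n).
Proof.
move=> k; elim: k n => [|k IH] n.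
  by move=> x _; apply/differentiable_continuous/derivable1_diffP/ex_derive/is_derive_flat.
apply: is_derive_class_C (is_derive_flat n) _.
by apply: class_CD openT _ _ => //; apply: class_CM openT _ _ => //; exact: class_C_cst.
Qed.

Lemma smooth_flatB n (a b : R) : smooth_on setT (fun s => flat n (a + b * s)).
Proof.
move=> k.
apply: (@class_C_comp_R _ _ _ _ setT setT (fun s => a + b * s) (flat n)
  has_coordinates_R openT openT) => //; last exact: smooth_flat.
apply: class_CD openT (class_C_cst _ _ _) _; apply: class_CM openT (class_C_cst _ _ _) _.
exact: class_C_id.
Qed.

(** A smooth cutoff that descends: 1 for s <= 0 and 0 for s >= 1. *)
Definition step s := flat 0 (1 - s) / (flat 0 (1 - s) + flat 0 s).

Lemma step_den_gt0 s : 0 < flat 0 (1 - s) + flat 0 s.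
Proof.
have [s0|s0] := leP s 0; last by rewrite ltr_wpDl ?flat_ge0 ?flat0_gt0.
by rewrite ltr_pwDl ?flat_ge0// flat0_gt0// subr_gt0 (le_lt_trans s0).
Qed.

Lemma step_ge0 s : 0 <= step s.
Proof. by rewrite divr_ge0 ?flat_ge0// ltW// step_den_gt0. Qed.

Lemma step_le1 s : step s <= 1.
Proof. by rewrite ler_pdivrMr ?step_den_gt0// mul1r lerDl flat_ge0. Qed.

Lemma step_left s : s <= 0 -> step s = 1.
Proof.
move=> s0; have := step_den_gt0 s; rewrite /step (flat_le0 0 s0) addr0 => h.
by rewrite mulfV// gt_eqF.
Qed.

Lemma step_right s : 1 <= s -> step s = 0.
Proof. by move=> s1; rewrite /step flat_le0 ?mul0r// subr_le0. Qed.

Lemma smooth_step : smooth_on setT step.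
Proof.
move=> k; have C1 : class_C k setT (fun s : R => flat 0 (1 - s)).
  by have := smooth_flatB 0 1 (-1) k; under eq_fun do rewrite mulN1r.
apply: (class_CM openT C1 _); apply: (class_CV openT).
  by move=> x _; rewrite gt_eqF// step_den_gt0.
exact: (class_CD openT C1 (smooth_flat 0 k)).
Qed.

(** With P = [flat 0 (1 - s)] and Q = [flat 0 s], the derivative of P/(P+Q) is (P'Q - PQ')/(P+Q)^2,
    where P' = [- flat 2 (1 - s)] and Q' = [flat 2 s]. *)
Lemma derive_step_le0 s : 'D_1 step s <= 0.
Proof.
have hB : is_derive s 1 (fun x : R => 1 - x) (-1).
  have := is_deriveB (is_derive_cst (1:R) s 1) (is_derive_id s 1).
  by rewrite sub0r.
have hP : is_derive s 1 (fun x : R => flat 0 (1 - x)) (- flat 2 (1 - s)).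
  have := @is_derive1_comp _ (flat 0) (fun x : R => 1 - x) _ _ _ (is_derive_flat 0 (1 - s)) hB.
  by rewrite oppr0 mul0r add0r mulrN1.
have hQ : is_derive s 1 (flat 0) (flat 2 s).
  by have := is_derive_flat 0 s; rewrite oppr0 mul0r add0r.
have n0 : flat 0 (1 - s) + flat 0 s != 0 by rewrite gt_eqF// step_den_gt0.
have hV := @is_deriveV _ (fun x => flat 0 (1 - x) + flat 0 x) _ _ _ n0 (is_deriveD hP hQ).
have [_ dE] := is_deriveM hP hV; have {dE} -> : 'D_1 step s = _ := dE.
have := step_den_gt0 s; set c := flat 0 (1 - s) + _ => c0.
rewrite /GRing.scale /=.
rewrite [leLHS](_ : _ = - (flat 0 (1 - s) * flat 2 s + flat 0 s * flat 2 (1 - s)) / c ^+ 2).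
  rewrite pmulr_lle0 ?invr_gt0 ?exprn_gt0// oppr_le0.
  by rewrite addr_ge0// mulr_ge0// flat_ge0.
rewrite -!exprVn -/c.
have : c^-1 * flat 2 (1 - s) = c * c^-1 ^+ 2 * flat 2 (1 - s).
  by rewrite expr2 mulrA mulfV ?mul1r// gt_eqF.
by rewrite {2}/c; lra.
Qed.

End Bump.

(** * Radial isotopies *)

Section SmoothInverse.
Context {R : realType}.

Lemma has_coordinates_plane : has_coordinates (plane R).
Proof. exact: (has_coordinates_prod has_coordinates_R has_coordinates_R). Qed.

Lemma class_C_continuous k (V W : normedModType R) (U : set V) (f : V -> W) x :
  class_C k U f -> U x -> {for x, continuous f}.
Proof. by elim: k => [|k IH]; [exact|move=> /class_CS]. Qed.

Lemma smooth_differentiable (V W : normedModType R) (U : set V) (f : V -> W) x :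
  smooth_on U f -> U x -> differentiable f x.
Proof. by move=> /(_ 1%N) [h _] /h. Qed.

Lemma smooth_continuous (V W : normedModType R) (U : set V) (f : V -> W) x :
  smooth_on U f -> U x -> {for x, continuous f}.
Proof. by move=> /(_ 0%N); exact. Qed.

(** Bootstrapping: g' = 1/(f' o g) is of class C^k as soon as [g] is. *)
Lemma smooth_inverse (f g : R -> R) : smooth_on setT f ->
  (forall x : R, 0 < 'D_1 f x) -> cancel f g -> cancel g f -> smooth_on setT g.
Proof.
move=> Cf f'0 fK gK.
have dg (y : R) : is_derive y 1 g ('D_1 f (g y))^-1.
  rewrite -{1}[y]gK; apply: (@is_derive_inverse _ f).
  - by near=> x; exact: fK.
  - by near=> x; exact: (smooth_continuous Cf).
  - apply/derivableP/diff_derivable; exact: (smooth_differentiable Cf).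
  - by rewrite gt_eqF.
elim=> [|k IH].
  by move=> y _; have [dy _] := dg y; exact/differentiable_continuous/derivable1_diffP.
apply: (is_derive_class_C dg); apply: (class_CV openT) => [x _|].
  by rewrite gt_eqF.
apply: (@class_C_comp_R _ _ _ _ setT setT g ('D_1 f) has_coordinates_R openT openT) => //.
by have [_ /(_ 1)] := Cf k.+1.
Unshelve. all: by end_near.
Qed.

Lemma derive_gt0_lt (f : R -> R) : smooth_on setT f ->
  (forall x : R, 0 < 'D_1 f x) -> forall x y, x < y -> f x < f y.
Proof.
move=> Cf f'0 x y xy.
apply: (@gtr0_derive1_lt_cc _ f x y) => //; rewrite ?in_itv /= ?lexx ?(ltW xy)//.
- by move=> z _; apply/diff_derivable/(smooth_differentiable Cf).
- by move=> z _; rewrite derive1E.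
- by apply: continuous_subspaceT => z; exact: (smooth_continuous Cf).
Qed.

(** The third hypothesis brackets every value, so the intermediate value theorem gives a preimage;
    strict monotonicity makes it unique. *)
Lemma smooth_bijection (f : R -> R) : smooth_on setT f ->
  (forall x : R, 0 < 'D_1 f x) -> (forall y, exists a b, f a <= y <= f b) ->
  exists g, [/\ smooth_on setT g, cancel f g & cancel g f].
Proof.
move=> Cf f'0 fy; have finc := derive_gt0_lt Cf f'0.
have /choice[g gK] : forall y, exists x, f x = y.
  move=> y; have [a [b /andP[ay yb]]] := fy y.
  have ab : a <= b.
    by rewrite leNgt; apply/negP => /finc; rewrite ltNge (le_trans ay yb).
  have [||x _ <-] := @IVT _ f a b y ab; last by exists x.
    by apply: continuous_subspaceT => z; exact: (smooth_continuous Cf).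
  by rewrite (min_idPl _) ?(max_idPr _) ?(le_trans ay yb)// ay yb.
have fK : cancel f g.
  move=> x; have := gK (f x).
  by have [/finc h e|/finc h e|//] := ltgtP (g (f x)) x; rewrite e ltxx in h.
by exists g; split=> //; exact: smooth_inverse Cf f'0 fK gK.
Qed.

End SmoothInverse.

(** * Radial contractions supported in a disc *)

Section Radial.
Context {R : realType}.
Variables (a b d : R).
Hypotheses (a0 : 0 <= a) (ab : a < b) (d01 : 0 < d < 1).

(** The scaling at time [t] on the circle of squared radius [s]: it is [1 - t * (1 - d)] for s <= a,
    hence [d] at time 1, and it is 1 for s >= b. *)
Definition factor (t s : R) := 1 - t * (1 - d) * step ((s - a) / (b - a)).

Lemma factor_ge t s : 0 <= t <= 1 -> d <= factor t s.
Proof.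
move=> t01; rewrite /factor.
have := step_ge0 ((s - a) / (b - a)); have := step_le1 ((s - a) / (b - a)).
set c := step _ => c1 c0.
suff : (t * c) * (1 - d) <= 1 * (1 - d) by lra.
have /andP[dgt0 dlt1] := d01; have /andP[t0 t1] := t01.
by apply: ler_wpM2r; [lra|nra].
Qed.

Lemma factor_left t s : s <= a -> factor t s = 1 - t * (1 - d).
Proof.
move=> sa; rewrite /factor step_left ?mulr1//.
by rewrite pmulr_lle0 ?invr_gt0 ?subr_gt0// subr_le0.
Qed.

Lemma factor_right t s : b <= s -> factor t s = 1.
Proof.
move=> bs; rewrite /factor step_right ?mulr0 ?subr0//.
by rewrite ler_pdivlMr ?subr_gt0// mul1r lerB.
Qed.

Lemma class_C_factor (V : normedModType R) (t s : V -> R) k :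
  class_C k setT t -> class_C k setT s ->
  class_C k setT (fun x => factor (t x) (s x)).
Proof.
move=> Ct Cs; have oV := @openT V.
have CN (f : V -> R) : class_C k setT f -> class_C k setT (fun x => - f x).
  move=> Cf; under eq_fun do rewrite -mulN1r.
  by apply: class_CM => //; exact: class_C_cst.
apply: (class_CD oV (class_C_cst _ _ _)); apply/CN; apply: (class_CM oV).
  exact: (class_CM oV Ct (class_C_cst _ _ _)).
apply: (@class_C_comp_R _ _ _ _ setT setT _ step has_coordinates_R oV (@openT _)) => //.
  apply: (class_CM oV _ (class_C_cst _ _ _)).
  by apply: (class_CD oV Cs); exact: class_C_cst.
exact: smooth_step.
Qed.

(** For s < 0 the factor is locally constant, since 0 <= a; for s >= 0 it is nondecreasing because
    [step] descends. The product form serves both signs in [radial_radius]. *)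
Lemma derive_factor t s : 0 <= t -> 0 <= s * 'D_1 (factor t) s.
Proof.
move=> t0; have [s0|s0] := ltP s 0.
  rewrite (@near_eq_derive _ _ _ _ (cst (1 - t * (1 - d)))) ?derive_cst ?mulr0//.
  near=> x; rewrite factor_left//; apply: le_trans a0.
  by near: x; exact: lt_le_nbhsl.
apply: mulr_ge0 => //.
have dA : is_derive s 1 (fun x : R => (x - a) / (b - a)) (b - a)^-1.
  have := is_deriveZ (b - a)^-1 (is_deriveB (is_derive_id s 1) (is_derive_cst a s 1)).
  rewrite subr0 /GRing.scale /= mulr1; congr is_derive.
  by apply/funext => x /=; rewrite mulrC.
have dS (x : R) : is_derive x 1 step ('D_1 step x).
  by apply/derivableP/diff_derivable; exact: (smooth_differentiable smooth_step).
have dC := @is_derive1_comp _ step _ _ _ _ (dS _) dA.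
have := is_deriveB (is_derive_cst (1 : R) s 1) (is_deriveZ (t * (1 - d)) dC).
move=> [_ dE]; have {dE} -> : 'D_1 (factor t) s = _ := dE.
have /andP[dgt0 dlt1] := d01.
rewrite sub0r -mulrN /GRing.scale /= mulr_ge0 ?mulr_ge0//; first lra.
by rewrite -mulNr mulr_ge0 ?oppr_ge0 ?derive_step_le0// invr_ge0 subr_ge0 ltW.
Unshelve. all: by end_near.
Qed.

(** Scaling through the squared norm keeps the map smooth at the origin. *)
Definition radial t (x : plane R) : plane R := factor t (sqnorm x) *: x.

Lemma sqnormZ c (x : plane R) : sqnorm (c *: x) = c ^+ 2 * sqnorm x.
Proof. by rewrite /sqnorm /= mulrDr !exprMn. Qed.

Lemma sqnorm_ge0 (x : plane R) : 0 <= sqnorm x.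
Proof. by rewrite addr_ge0 ?sqr_ge0. Qed.

Lemma class_C_sqnorm k (V : normedModType R) (f : V -> plane R) :
  class_C k setT f -> class_C k setT (fun x => sqnorm (f x)).
Proof.
move=> Cf; have oV := @openT V; rewrite /sqnorm.
have C1 := class_C_fst oV Cf; have C2 := class_C_snd oV Cf.
by apply: (class_CD oV); rewrite ?expr2; apply: (class_CM oV).
Qed.

(** This is the effect of [radial t] on squared norms, extended to negative [s]. With m =
    [factor t], its derivative is m^2 + 2 m (s m'), positive by [derive_factor]. *)
Lemma radial_radius t : 0 <= t <= 1 -> exists psi : R -> R,
  [/\ smooth_on setT psi, cancel (fun s => factor t s ^+ 2 * s) psi &
      cancel psi (fun s => factor t s ^+ 2 * s)].
Proof.
move=> t01; have /andP[t0 t1] := t01; have /andP[dgt0 dlt1] := d01.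
have Cm k : class_C k setT (factor t).
  apply: (@class_C_factor _ (fun=> t) id k); first exact: class_C_cst.
  exact: class_C_id.
have m0 s : 0 < factor t s by apply: lt_le_trans dgt0 (factor_ge s t01).
apply: smooth_bijection => [k|x|y].
- apply: (class_CM openT _ (class_C_id _ _)); under eq_fun do rewrite expr2.
  exact: (class_CM openT (Cm k) (Cm k)).
- have dm : is_derive x 1 (factor t) ('D_1 (factor t) x).
    by apply/derivableP/diff_derivable; apply: (smooth_differentiable (U := setT)).
  have := is_deriveM (is_deriveM dm dm) (is_derive_id x (1 : R)).
  move=> [_ dE].
  have -> : (fun s => factor t s ^+ 2 * s) = factor t * factor t * id.
    by apply/funext => s; rewrite expr2.
  rewrite dE.
  rewrite /GRing.scale /= mulr1 ltr_pwDl ?mulr_gt0//.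
  have := mulr_ge0 (ltW (m0 x)) (derive_factor x t0); lra.
(* Brackets for [y]: for s <= 0 the map is multiplication by [m ^+ 2], and for s >= b it is the
   identity. *)
- pose m := 1 - t * (1 - d).
  have mE : factor t 0 = m by rewrite factor_left.
  have mgt0 : 0 < m ^+ 2 by rewrite -mE exprn_gt0.
  exists (Num.min 0 (y / m ^+ 2)), (Num.max b y); apply/andP; split.
    rewrite factor_left -/m; last by rewrite (le_trans _ a0)// ge_min lexx.
    by rewrite mulrC -ler_pdivlMr// ge_min lexx orbT.
  rewrite factor_right; last by rewrite le_max lexx.
  by rewrite expr1n mul1r le_max lexx orbT.
Qed.

(** To invert, [psi] recovers the original squared norm from that of the image; then one divides by
    the factor found there. *)
Lemma radial_diffeo t : 0 <= t <= 1 -> plane_diffeo (radial t).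
Proof.
move=> t01; have /andP[dgt0 _] := d01.
have m0 s : factor t s != 0 by rewrite gt_eqF// (lt_le_trans dgt0 (factor_ge s t01)).
have [psi [Cpsi psiK Kpsi]] := radial_radius t01.
exists (fun y => (factor t (psi (sqnorm y)))^-1 *: y); split.
- move=> k; apply: (class_CZ has_coordinates_plane openT _ (class_C_id _ _)).
  by apply: class_C_factor; [exact: class_C_cst|apply/class_C_sqnorm/class_C_id].
- move=> k; apply: (class_CZ has_coordinates_plane openT _ (class_C_id _ _)).
  apply: (class_CV openT) => [x _ //|].
  apply: class_C_factor; first exact: class_C_cst.
  apply: (@class_C_comp_R _ _ _ _ setT setT _ psi has_coordinates_R openT openT) => //.
  exact/class_C_sqnorm/class_C_id.
- move=> x; rewrite /radial sqnormZ psiK scalerA mulVf ?scale1r//.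
- move=> y; rewrite /radial sqnormZ exprVn.
  rewrite (_ : _ * sqnorm y = psi (sqnorm y)) ?scalerA ?mulfV ?scale1r//.
  by rewrite -{2}(Kpsi (sqnorm y)) mulKf// expf_neq0.
Qed.

Lemma radial_isotopy (S : set (plane R)) :
  [set x | sqnorm x <= b] `<=` S° -> surface_isotopy S radial.
Proof.
move=> bS; split.
- exists setT; split=> //; first exact: openT.
  move=> k; apply: (class_CZ has_coordinates_plane openT).
    apply: class_C_factor; first exact: (class_C_fst openT (class_C_id _ _)).
    exact/class_C_sqnorm/(class_C_snd openT (class_C_id _ _)).
  exact: (class_C_snd openT (class_C_id _ _)).
- by move=> x; rewrite /radial /factor !mul0r subr0 scale1r.
- exact: radial_diffeo.
exists [set x | sqnorm x <= b]; split => //; last first.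
  move=> t x _ /negP; rewrite -ltNge => bx.
  by rewrite /radial factor_right ?ltW// scale1r.
have b0 : 0 <= b by rewrite ltW// (le_lt_trans a0).
(* The square of half-side [b + 1] contains the support, since u^2 <= b forces |u| <= b + 1. *)
apply: (@subclosed_compact _ _ (`[-(b + 1), b + 1] `*` `[-(b + 1), b + 1])).
- apply: (@closed_comp _ _ sqnorm [set s | s <= b]); last exact: closed_le.
  move=> x _; apply: (@class_C_continuous _ 0 _ _ setT) => //.
  exact/class_C_sqnorm/class_C_id.
- by apply: compact_setX; exact: segment_compact.
- move=> [x y]; rewrite /sqnorm /= => h; split; rewrite /= in_itv /=.
    by nra.
  by nra.
Qed.

End Radial.

(** * Functoriality of classes *)

Section Charts.
Context {R : realType}.
Implicit Types (U V W : set (plane R)) (f g : plane R -> plane R).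

Lemma open_preimage_on (X Y : normedModType R) (A : set X) (B : set Y) (f : X -> Y) :
  open A -> open B -> smooth_on A f -> open (A `&` f @^-1` B).
Proof.
move=> oA oB Cf; rewrite openE => x [Ax Bx]; apply: filterI.
  by apply: open_nbhs_nbhs.
by apply: (smooth_continuous Cf Ax); exact: open_nbhs_nbhs.
Qed.

Lemma smooth_on_comp (X Y : normedModType R) (A : set X) (B : set Y)
    (f' : X -> Y) (h : Y -> plane R) :
  has_coordinates Y -> open A -> open B -> (forall x, A x -> B (f' x)) ->
  smooth_on A f' -> smooth_on B h -> smooth_on A (fun x => h (f' x)).
Proof.
move=> hY oA oB AB Cf Ch k.
exact: (class_C_comp hY has_coordinates_plane oA oB AB (Cf k) (Ch k)).
Qed.

Lemma smooth_near_comp (X : normedModType R) (A : set X) U (s : X -> plane R) f :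
  open U -> smooth_on U f -> (forall x, A x -> U (s x)) ->
  smooth_near A s -> smooth_near A (fun x => f (s x)).
Proof.
move=> oU Cf AU [B [oB AB Cs]].
exists (B `&` s @^-1` U); split; first exact: open_preimage_on.
  by move=> x Ax; split; [exact: AB|exact: AU].
apply: (smooth_on_comp has_coordinates_plane _ oU _ _ Cf) => [|x []//|k].
  exact: open_preimage_on.
by apply: class_C_sub (Cs k) => x [].
Qed.

(** The witnesses of [embedding] made explicit, so that they can be restricted, inverted and
    composed. *)
Definition chart U f g : Prop :=
  [/\ open U, open (f @` U), smooth_on U f, smooth_on (f @` U) g &
      forall x, U x -> g (f x) = x].

Lemma chart_id : chart setT id id.
Proof.
by split => //; rewrite ?image_id; try exact: openT; move=> k; exact: class_C_id.
Qed.

Lemma chart_inj U f g x y : chart U f g -> U x -> U y -> f x = f y -> x = y.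
Proof. by move=> [_ _ _ _ gf] Ux Uy e; rewrite -(gf x Ux) -(gf y Uy) e. Qed.

Lemma chart_restrict U V f g : chart U f g -> open V -> V `<=` U -> chart V f g.
Proof.
move=> [oU ofU Cf Cg gf] oV VU; split=> //.
(* The image of [V] is open because it is the preimage of [V] under the continuous inverse [g]. *)
- rewrite (_ : f @` V = f @` U `&` g @^-1` V); first exact: open_preimage_on.
  apply/seteqP; split=> [_ [x Vx <-]|_ [[x Ux <-]]]; last by rewrite /= gf//; exists x.
  by split; [exists x => //; exact: VU|rewrite /= gf//; exact: VU].
- by move=> k; apply: class_C_sub (Cf k).
- by move=> k; apply: class_C_sub (Cg k); exact: image_subset.
- by move=> x /VU /gf.
Qed.

Lemma chart_sym U f g : chart U f g -> chart (f @` U) g f.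
Proof.
move=> [oU ofU Cf Cg gf].
have gU : g @` (f @` U) = U.
  apply/seteqP; split=> [_ [_ [x Ux <-] <-]|x Ux]; first by rewrite gf.
  by exists (f x); [exists x|rewrite gf].
by split; rewrite ?gU// => _ [x Ux <-]; rewrite gf.
Qed.

Lemma chart_comp U V f g f' g' : chart U f g -> chart V f' g' ->
  f @` U `<=` V -> chart U (f' \o f) (g \o g').
Proof.
move=> cU cV fUV; have [oU ofU Cf Cg gf] := cU.
have [oV _ Cf' _ _] := cV; have [_ of'fU _ Cg' gf'] := chart_restrict cV ofU fUV.
have UV x : U x -> V (f x) by move=> Ux; apply: fUV; exists x.
have imE : (f' \o f) @` U = f' @` (f @` U) by rewrite image_comp.
split; rewrite ?imE//.
- exact: (smooth_on_comp has_coordinates_plane oU oV UV Cf Cf').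
- apply: (smooth_on_comp has_coordinates_plane of'fU ofU _ Cg' Cg).
  by move=> _ [y fUy <-]; rewrite gf'.
- by move=> x Ux; rewrite /= gf' ?gf//; exists x.
Qed.

Lemma chart_embedding (X : set (plane R)) U f g :
  chart U f g -> X `<=` U -> embedding X f.
Proof. by move=> [oU ofU Cf Cg gf] XU; exists U, g; split. Qed.

Lemma det2_linear (L : {linear plane R -> plane R}) u v :
  det2 (L u) (L v) = det2 (L (1, 0)) (L (0, 1)) * det2 u v.
Proof.
have E w : L w = w.1 *: L (1, 0) + w.2 *: L (0, 1).
  rewrite -!linearZ -linearD /=; congr (L _).
  case: w => x y /=.
  have -> : x *: (1, 0) + y *: (0, 1) = (x * 1 + y * 0, x * 0 + y * 1) :> plane R by [].
  by rewrite !mulr1 !mulr0 addr0 add0r.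
rewrite (E u) (E v) /det2 /=; set c := L (1, 0); set e := L (0, 1).
rewrite /GRing.scale /=; lra.
Qed.

Lemma chart_diffK U f g x v : chart U f g -> U x -> 'd g (f x) ('d f x v) = v.
Proof.
move=> [oU ofU Cf Cg gf] Ux.
have df := smooth_differentiable Cf Ux.
have dg : differentiable g (f x) by apply: (smooth_differentiable Cg); exists x.
have e : 'D_v (fun y => g (f y)) x = 'd g (f x) ('d f x v).
  by rewrite (derive_comp v df dg) deriveE.
rewrite -e (@near_eq_derive _ _ _ _ id) ?derive_id//.
by apply: filterS (open_nbhs_nbhs (conj oU Ux)) => y /gf.
Qed.

(** Needed for transversality of pushed crossings. The factor is the Jacobian determinant; were it
    0, applying the differential of [g], which inverts that of [f], would make the determinant of
    the standard basis vanish. *)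
Lemma chart_det U f g x : chart U f g -> U x ->
  exists2 k, k != 0 & forall u v, det2 ('d f x u) ('d f x v) = k * det2 u v.
Proof.
move=> cU Ux; exists (det2 ('d f x (1, 0)) ('d f x (0, 1))); last exact: det2_linear.
apply/eqP => k0.
have K1 := chart_diffK (1, 0) cU Ux; have K2 := chart_diffK (0, 1) cU Ux.
move: ('d f x (1, 0)) ('d f x (0, 1)) ('d g (f x)) k0 K1 K2 => u v L k0 K1 K2.
have := det2_linear L u v; rewrite k0 mulr0 K1 K2 /det2 /=.
by rewrite mulr1 mulr0 subr0 => /eqP; rewrite oner_eq0.
Qed.

End Charts.

(** * Pushing diagrams and reparametrizations along a chart *)

Section Push.
Context {R : realType} (S T U : set (plane R)) (f g : plane R -> plane R).
Hypotheses (cU : chart U f g) (SU : S° `<=` U) (ST : forall x, S° x -> T° (f x)).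

Definition push_strands n (s : strands n) : strands n := fun c t => f (s c t).

Definition inside n (s : strands n) : Prop :=
  forall p, in_source p -> S° (at_pt s p : plane R).

Lemma smooth_near_differentiable (X : set R) (h : R -> plane R) t :
  smooth_near X h -> X t -> differentiable h t.
Proof. by move=> [V [oV XV Ch]] Xt; apply: (smooth_differentiable Ch); exact: XV. Qed.

Lemma velocity_push n (s : strands n) p :
  smooth_near (dom p.1) (s p.1) -> in_source p -> U (at_pt s p) ->
  velocity (push_strands s) p = 'd f (at_pt s p) (velocity s p).
Proof.
move=> Cs sp Up; have [_ _ Cf _ _] := cU.
have ds := smooth_near_differentiable Cs sp.
have df : differentiable f (s p.1 p.2) := smooth_differentiable Cf Up.
by rewrite /velocity !derive1E /push_strands (derive_comp (1 : R) ds df).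
Qed.

(** Double points, endpoint conditions and the clauses of the Reidemeister moves ask which source
    points share an image; this carries them across the chart. *)
Lemma push_eq n (s s' : strands n) p q : inside s -> inside s' ->
  in_source p -> in_source q ->
  (at_pt (push_strands s) p = at_pt (push_strands s') q) <-> (at_pt s p = at_pt s' q).
Proof.
move=> is_ is' sp sq; split=> [e|e].
  by apply: (chart_inj cU) e; apply: SU; [exact: is_|exact: is'].
by rewrite /at_pt /push_strands -/(at_pt s p) e.
Qed.

Lemma double_pt_push n (s : strands n) p q : inside s ->
  double_pt (push_strands s) p q <-> double_pt s p q.
Proof.
by move=> is_; split=> -[sp sq npq e]; split=> //; apply/(push_eq is_ is_ sp sq).
Qed.

Lemma is_diagram_push D : is_diagram S D -> is_diagram T (push f D).
Proof.
case: D => n s o [[[Cs per is_ vel] [tr trip leg head]] [v1 v2]].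
have [oU _ Cf _ _] := cU.
have dp p q := @double_pt_push n s p q is_.
split; [split; split|split].
- move=> c; apply: (smooth_near_comp oU Cf _ (Cs c)) => t ct.
  by apply: SU; apply: (is_ (c, t)).
- by move=> i t; rewrite /push /=; congr (f _); exact: per.
- by move=> p /is_ /ST.
- move=> p sp; apply/eqP.
  have Up : U (at_pt s p) by exact/SU/is_.
  rewrite -[velocity _ _]/(velocity (push_strands s) p) velocity_push//.
  move=> v0; apply/negP: (vel p sp); rewrite negbK; apply/eqP.
  exact: (etrans (esym (chart_diffK _ cU Up)) (etrans (congr1 _ v0) (linear0 _))).
- move=> p q /dp dpq; have [sp sq _ e] := dpq.
  have Up : U (at_pt s p) by exact/SU/is_.
  rewrite -[velocity _ p]/(velocity (push_strands s) p).
  rewrite -[velocity _ q]/(velocity (push_strands s) q).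
  rewrite !velocity_push// -?e//.
  have [k k0 ->] := chart_det cU Up.
  by rewrite mulf_neq0//; exact: tr.
- by move=> p q u /dp pq /dp qu; exact: (trip _ _ _ pq qu).
- by move=> p sp /(@push_eq n s s (None, 0) p is_ is_ _ sp) e; apply: leg => //; apply: e;
    rewrite /in_source /= lexx ler01.
- by move=> p sp /(@push_eq n s s (None, 1) p is_ is_ _ sp) e; apply: head => //; apply: e;
    rewrite /in_source /= lexx ler01.
- by move=> p q /dp; exact: v1.
- by move=> p q p' q' /dp; exact: v2.
Qed.

Lemma reparametrization_push D E : is_diagram S D ->
  reparametrization D E -> reparametrization (push f D) (push f E).
Proof.
case: D => n s o; case: E => m s' o' [[[_ _ is_ _] _] _].
move=> [sigma [theta [[bs sN Ct vt] [t01 per pos ov]]]].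
exists sigma, theta; split; split=> //=.
  by move=> p /pos /= e; rewrite /at_pt /= -[s' _ _]/(at_pt s' (_, _)) e.
by move=> p q /(double_pt_push _ _ is_); exact: ov.
Qed.

End Push.

(** * Conjugating isotopies by a chart *)

Section Conjugation.
Context {R : realType}.
Implicit Types (S T U K : set (plane R)) (f g h : plane R -> plane R).

(** If [h x] is not in [K], then [h] fixes [h x], and injectivity gives [h x = x]. *)
Lemma support_stable K U h : injective h -> (forall x, ~ K x -> h x = x) ->
  K `<=` U -> forall x, U x -> U (h x).
Proof.
move=> hI hK KU x Ux; have [Khx|nKhx] := pselect (K (h x)); first exact: KU.
by have /hI -> := hK _ nKhx.
Qed.

Lemma diffeo_chart f g : smooth_on setT f -> smooth_on setT g ->
  cancel f g -> cancel g f -> chart setT f g.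
Proof.
move=> Cf Cg fK gK; have fT : f @` setT = setT.
  by apply/seteqP; split=> // y _; exists (g y).
by split; rewrite ?fT//; exact: openT.
Qed.

(* Outside [0,1] an isotopy is unconstrained, so its time is reparametrized by a
   smooth step with values in [0,1]. *)
Lemma isotopy_normalize S H : surface_isotopy S H -> exists H',
  [/\ H' 1 = H 1, forall x, H' 0 x = x,
      smooth_on setT (fun p : R * plane R => H' p.1 p.2) &
      forall t, exists2 t', 0 <= t' <= 1 & H' t = H t'].
Proof.
move=> [[W [oW sW CH]] H0 _ _].
have t01 (t : R) : 0 <= 1 - step t <= 1.
  by rewrite subr_ge0 step_le1 lerBlDr lerDl step_ge0.
exists (fun t => H (1 - step t)); split.
- by rewrite step_right// subr0.
- by move=> x; rewrite step_left// subrr.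
- apply: (@smooth_on_comp _ _ _ setT W (fun p : R * plane R => (1 - step p.1, p.2))
    (fun p : R * plane R => H p.1 p.2)) CH => //.
  + exact: has_coordinates_prod has_coordinates_R has_coordinates_plane.
  + exact: openT.
  + by move=> p _; apply: sW; exact: t01.
  move=> k; apply: (class_C_pair openT); last exact: (class_C_snd openT (class_C_id _ _)).
  apply: (class_CD openT (class_C_cst _ _ _)); under eq_fun do rewrite -mulN1r.
  apply: (class_CM openT (class_C_cst _ _ _)).
  apply: (@class_C_comp_R _ _ _ _ setT setT fst step has_coordinates_R openT openT) => //.
    exact: (class_C_fst openT (class_C_id _ _)).
  exact: smooth_step.
- by move=> t; exists (1 - step t).
Qed.

Section Conjugate.
Variables (U : set (plane R)) (f g : plane R -> plane R).
Hypothesis cU : chart U f g.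

Definition conj_chart h (y : plane R) : plane R :=
  if `[< (f @` U) y >] then f (h (g y)) else y.

Lemma conj_chartE h x : U x -> conj_chart h (f x) = f (h x).
Proof.
move=> Ux; have [_ _ _ _ gf] := cU.
by rewrite /conj_chart ifT ?gf//; apply/asboolP; exists x.
Qed.

Lemma conj_chart_out h y : ~ (f @` U) y -> conj_chart h y = y.
Proof. by move=> ny; rewrite /conj_chart ifF//; apply/asboolPn. Qed.

Lemma conj_chart_support K h y : (forall x, ~ K x -> h x = x) -> ~ (f @` K) y ->
  conj_chart h y = y.
Proof.
move=> hK nKy; have [[x Ux fx]|] := pselect ((f @` U) y); last exact: conj_chart_out.
by rewrite -fx conj_chartE// hK// => Kx; apply: nKy; exists x.
Qed.

Lemma conj_chartK h h' : (forall x, U x -> U (h x)) -> cancel h h' ->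
  cancel (conj_chart h) (conj_chart h').
Proof.
move=> hU hK y; have [[x Ux <-]|ny] := pselect ((f @` U) y); last first.
  by rewrite !(conj_chart_out _ ny).
by rewrite !conj_chartE ?hK//; exact: hU.
Qed.

(** Two open sets cover the plane: the image of [U], where the map is a composite of smooth maps,
    and the complement of the image of [K], where it is the identity. The latter is open because [K]
    is compact. *)
Lemma smooth_conj_chart K (h : R -> plane R -> plane R) :
  compact K -> K `<=` U -> (forall t x, ~ K x -> h t x = x) ->
  (forall t x, U x -> U (h t x)) ->
  smooth_on setT (fun p : R * plane R => h p.1 p.2) ->
  smooth_on setT (fun p : R * plane R => conj_chart (h p.1) p.2).
Proof.
move=> cK KU hK hU Ch k; have [oU ofU Cf Cg gf] := cU.
have snd_cont (x : R * plane R) : {for x, continuous snd} by exact: cvg_snd.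
have osnd (A : set (plane R)) : open A -> open (snd @^-1` A : set (R * plane R)).
  by move=> oA; apply: open_comp => // x _; exact: snd_cont.
have clK : closed (f @` K).
  apply: compact_closed; first exact: norm_hausdorff.
  apply: continuous_compact => //; apply: continuous_in_subspaceT => x /set_mem /KU Ux.
  exact: (smooth_continuous Cf).
apply: class_C_cover => -[t y] _.
have [fUy|nfUy] := pselect ((f @` U) y).
  exists (snd @^-1` (f @` U)) => //.
  apply: (class_C_eq (osnd _ ofU) (f := fun p : R * plane R => f (h p.1 (g p.2)))).
    by move=> [t' y'] /set_mem [x Ux /= <-]; rewrite gf// conj_chartE.
  apply: (@smooth_on_comp _ _ _ (snd @^-1` (f @` U)) U
    (fun p : R * plane R => h p.1 (g p.2)) f has_coordinates_plane (osnd _ ofU) oU) => //.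
    by move=> [t' y'] [x Ux /= <-]; apply: hU; rewrite gf.
  apply: (@smooth_on_comp _ _ _ (snd @^-1` (f @` U)) setT
    (fun p : R * plane R => (p.1, g p.2)) (fun p : R * plane R => h p.1 p.2)) => //.
  - exact: (has_coordinates_prod has_coordinates_R has_coordinates_plane).
  - exact: osnd.
  - exact: openT.
  move=> j; apply: (class_C_pair (osnd _ ofU)).
    exact: (class_C_fst (osnd _ ofU) (class_C_id _ _)).
  apply: (@class_C_comp _ _ _ _ _ _ (f @` U) snd g has_coordinates_plane
    has_coordinates_plane (osnd _ ofU) ofU) => //.
  exact: (class_C_snd (osnd _ ofU) (class_C_id _ _)).
have oKc : open (snd @^-1` (~` (f @` K)) : set (R * plane R)).
  by apply: osnd; exact: closed_openC.
exists (snd @^-1` (~` (f @` K))).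
  by move=> -[x Kx fx]; apply: nfUy; exists x => //; exact: KU.
apply: (class_C_eq oKc (f := fun p : R * plane R => p.2)).
  by move=> [t' y'] /set_mem /= nK; rewrite (conj_chart_support (hK t') nK).
exact: (class_C_snd oKc (class_C_id _ _)).
Qed.

Lemma smooth_conj_chart1 K h :
  compact K -> K `<=` U -> (forall x, ~ K x -> h x = x) ->
  (forall x, U x -> U (h x)) -> smooth_on setT h -> smooth_on setT (conj_chart h).
Proof.
move=> cK KU hK hU Ch.
have C : smooth_on setT (fun p : R * plane R => conj_chart h p.2).
  apply: (@smooth_conj_chart K (fun=> h)) => // k.
  apply: (@class_C_comp _ _ _ _ _ setT setT snd h has_coordinates_plane
    has_coordinates_plane openT openT) => //.
  exact: (class_C_snd openT (class_C_id _ _)).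
(* The constant family is frozen at time 0. *)
apply: (@smooth_on_comp _ _ _ setT setT (fun y => (0, y))
  (fun p : R * plane R => conj_chart h p.2)) C => //.
- exact: (has_coordinates_prod has_coordinates_R has_coordinates_plane).
- exact: openT.
- exact: openT.
- move=> k; apply: (class_C_pair openT (class_C_cst _ _ _) (class_C_id _ _)).
Qed.

(** Each stage is conjugated by the chart and extended by the identity. The inverse of a stage also
    fixes the points off [K], so its conjugate is smooth for the same reason. *)
Lemma isotopy_conj S T H : S° `<=` U -> (forall x, S° x -> T° (f x)) ->
  surface_isotopy S H ->
  exists2 G, surface_isotopy T G & forall x, U x -> G 1 (f x) = f (H 1 x).
Proof.
move=> SU ST /[dup] iH [_ _ dH [K [cK KS HK]]].
have [H' [H'1 H'0 CH' H'H]] := isotopy_normalize iH.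
have KU : K `<=` U by move=> x /KS /SU.
have H'K t x : ~ K x -> H' t x = x.
  by have [t' t01 ->] := H'H t => nK; exact: HK.
have dH' t : plane_diffeo (H' t) by have [t' /dH + ->] := H'H t.
have H'U t x : U x -> U (H' t x).
  by apply: support_stable (H'K t) KU _; have [k [_ _ /can_inj]] := dH' t.
exists (fun t => conj_chart (H' t)); last by move=> x Ux; rewrite conj_chartE// H'1.
split.
- exists setT; split=> //; first exact: openT.
  exact: (smooth_conj_chart cK KU H'K H'U CH').
- move=> y; have [[x Ux <-]|ny] := pselect ((f @` U) y); last exact: conj_chart_out.
  by rewrite conj_chartE// H'0.
- move=> t _; have [k [Ch Ck hk kh]] := dH' t.
  have kK x : ~ K x -> k x = x by move=> /H'K e; rewrite -{1}(e t) hk.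
  have kU x : U x -> U (k x) by apply: support_stable kK KU _; exact: can_inj kh.
  exists (conj_chart k); split.
  + exact: (smooth_conj_chart1 cK KU (H'K t) (H'U t) Ch).
  + exact: (smooth_conj_chart1 cK KU kK kU Ck).
  + exact: (conj_chartK (H'U t) hk).
  + exact: (conj_chartK kU kh).
exists (f @` K); split.
- have [_ _ Cf _ _] := cU.
  apply: continuous_compact => //; apply: continuous_in_subspaceT => x /set_mem /KU Ux.
  exact: (smooth_continuous Cf).
- by move=> _ [x /KS /ST ? <-].
- by move=> t y _; exact: (conj_chart_support (H'K t)).
Qed.

End Conjugate.
End Conjugation.

(** * Pushing isotopies and Reidemeister moves along a chart *)

Section PushEquivalence.
Context {R : realType}.

Lemma reparametrization_source n (s s' : strands n) (o : @crossing_info R n) :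
  (forall p, in_source p -> at_pt s' p = at_pt s p :> plane R) ->
  reparametrization (Diagram s o) (Diagram s' o).
Proof.
move=> ss'; exists id, (fun _ => id).
split; split=> //.
- by exists id.
- move=> c; exists setT; split; [exact: openT|by []|move=> k; exact: class_C_id].
- by move=> p _; rewrite derive1_id oner_eq0.
- by move=> i; exists 1; [left|].
- by move=> [p1 p2] [q1 q2] _.
Qed.

(* [s'] and [H 1] of [s] need only agree on the source: [strand] has arbitrary
   values off [0,1], which a trivial reparametrization discards. *)
Lemma equivalent_isotopy S H n (s s' : strands n) (o : @crossing_info R n) :
  surface_isotopy S H ->
  is_diagram S (Diagram s o) -> is_diagram S (Diagram s' o) ->
  (forall p, in_source p -> at_pt s' p = H 1 (at_pt s p)) ->
  equivalent S (Diagram s o) (Diagram s' o).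
Proof.
move=> iH ds ds' ss'; have [_ _ dH [K [_ KS HK]]] := iH.
have t1 : 0 <= (1 : R) <= 1 by rewrite ler01 lexx.
have [k [CH Ck Hk kH]] := dH 1 t1.
have dHs : is_diagram S (push (H 1) (Diagram s o)).
  apply: (is_diagram_push (diffeo_chart CH Ck Hk kH)) ds => // x.
  by apply: (support_stable (can_inj Hk) _ KS) => y; exact: HK.
apply: (@rst_trans _ _ _ (push (H 1) (Diagram s o))); apply: rst_step; split=> //.
  by apply: Or32; exists H.
by apply: Or31; exact: reparametrization_source.
Qed.

Context (S T U : set (plane R)) (f g : plane R -> plane R).
Hypotheses (cU : chart U f g) (SU : S° `<=` U) (ST : forall x, S° x -> T° (f x)).

Lemma isotopic_push D E : is_diagram S D -> is_diagram S E ->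
  isotopic S D E -> equivalent T (push f D) (push f E).
Proof.
move=> dD dE [H iH ED].
have dfD := is_diagram_push cU SU ST dD; have dfE := is_diagram_push cU SU ST dE.
have [G iG GE] := isotopy_conj cU SU ST iH.
case: D ED dD dfD => n s o ED [[[_ _ is_ _] _] _] dfD; rewrite ED in dfE *.
apply: (equivalent_isotopy iG dfD dfE) => p sp.
by symmetry; apply: GE; apply: SU; exact: is_.
Qed.

(** Used for the boundary condition of [tangle_in]. One direction is continuity of [f], the other
    openness of the image of the interior. *)
Lemma chart_interior B x : B `<=` U -> U x -> (f @` B)° (f x) <-> B° x.
Proof.
move=> BU Ux; have [oU _ Cf _ gf] := cU; split=> [fBx|Bx].
  have : (U `&` f @^-1` (f @` B)°) x by [].
  have oP : open (U `&` f @^-1` (f @` B)°).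
    by apply: open_preimage_on => //; exact: open_interior.
  move=> /(conj oP)/open_nbhs_nbhs; apply: filterS => y [Uy /interior_subset [z Bz]].
  by move=> /(chart_inj cU (BU _ Bz) Uy) <-.
have BU' : B° `<=` U by move=> y /interior_subset /BU.
have [_ oB _ _ _] := chart_restrict cU (open_interior _) BU'.
have : (f @` B°) (f x) by exists x.
move=> /(conj oB)/open_nbhs_nbhs; apply: filterS => _ [y By <-].
by exists y => //; exact: interior_subset.
Qed.

Lemma embedding_push phi : embedding disc phi -> phi @` disc `<=` U ->
  embedding disc (f \o phi).
Proof.
move=> [V [h [[oV dV] opV Cphi Ch hphi]]] phiU.
have [oU _ _ _ _] := cU.
have cV : chart V phi h by split.
(* The domain of [phi] may reach points sent outside [U], so it is cut down before composing. *)
have oW : open (V `&` phi @^-1` U) by exact: open_preimage_on.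
have cW : chart (V `&` phi @^-1` U) phi h by apply: (chart_restrict cV) => // x [].
apply: (chart_embedding (chart_comp cW cU _)); first by move=> _ [x [_ Ux] <-].
by move=> x dx; split; [exact: dV|apply: phiU; exists x].
Qed.

Context (n : nat).
Implicit Types (s : @strands R n) (o : @crossing_info R n) (a b : @subarc R n).

Lemma local_move_push A s o s' o' : inside S s -> inside S s' ->
  local_move S A s o s' o' ->
  local_move T A (push_strands f s) o (push_strands f s') o'.
Proof.
move=> is_ is' [prA [phi [ephi phiS] [tg tg' ss' oo']]]; split=> //.
have phiU : phi @` disc `<=` U by move=> x /phiS /SU.
have tg_push t : inside S t -> tangle_in (phi @` disc) A t ->
    tangle_in ((f \o phi) @` disc) A (push_strands f t).
  move=> it tgt p sp; have [<- <-] := tgt p sp.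
  have Up : U (at_pt t p) by exact/SU/it.
  rewrite -(image_comp phi f); split; last exact: chart_interior.
  split=> [[z Bz]|Bp]; last by exists (at_pt t p).
  by move=> /(chart_inj cU (phiU _ Bz) Up) <-.
exists (f \o phi).
  split; first exact: embedding_push.
  by rewrite -(image_comp phi f) => _ [x /phiS Sx <-]; exact: ST.
split; [exact: tg_push|exact: tg_push| |].
  by move=> p sp /(ss' p sp) e; apply/(push_eq cU SU is' is_).
by move=> p q /(double_pt_push cU SU p q is_); exact: oo'.
Qed.

Lemma proper_source a t : proper_subarc a -> cl_par a t -> in_source (scomp a, t).
Proof.
rewrite /proper_subarc /in_source /cl_par /dom /=.
case: (scomp a) => //= -[_ [a0 a1]] /andP[at_ ta].
by rewrite (le_trans (ltW a0))//= (le_trans ta)// ltW.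
Qed.

Lemma along_push s a b t u : inside S s ->
  proper_subarc a -> proper_subarc b -> cl_par a t -> cl_par b u ->
  (along (push_strands f s) a t = along (push_strands f s) b u) <->
  (along s a t = along s b u).
Proof.
move=> is_ pa pb at_ bu.
exact: (push_eq cU SU is_ is_ (proper_source pa at_) (proper_source pb bu)).
Qed.

Lemma simple_on_push s a : inside S s -> proper_subarc a ->
  simple_on s a -> simple_on (push_strands f s) a.
Proof. by move=> is_ pa sa t u at_ au /(along_push is_ pa pa at_ au); exact: sa. Qed.

Lemma op_cl_par a t : op_par a t -> cl_par a t.
Proof. by move=> /andP[h k]; rewrite /cl_par /= !ltW. Qed.

Lemma crosses_over_once_push s o a b t u : inside S s ->
  proper_subarc a -> proper_subarc b ->
  crosses_over_once s o a b t u -> crosses_over_once (push_strands f s) o a b t u.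
Proof.
move=> is_ pa pb [at_ bu e oab uniq_]; split=> //.
  by apply/(along_push is_ pa pb (op_cl_par at_) (op_cl_par bu)).
by move=> t' u' at' bu' /(along_push is_ pa pb at' bu'); exact: uniq_.
Qed.

Lemma R1_push s o s' o' : inside S s -> inside S s' ->
  R1 S s o s' o' -> R1 T (push_strands f s) o (push_strands f s') o'.
Proof.
move=> is_ is' [a [lm sa [t [u [at_ au tu e uniq_]]]]].
have pa : proper_subarc a by apply: lm.1.
exists a; split; [exact: local_move_push|exact: simple_on_push|].
exists t, u; split=> //.
  by apply/(along_push is_ pa pa (op_cl_par at_) (op_cl_par au)).
by move=> t' u' at' au' tu' /(along_push is_ pa pa at' au'); exact: uniq_.
Qed.

Lemma R2_push s o s' o' : inside S s -> inside S s' ->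
  R2 S s o s' o' -> R2 T (push_strands f s) o (push_strands f s') o'.
Proof.
move=> is_ is' [a [b [lm [sa sb sa' sb'] dis [t1 [u1 [t2 [u2 [ltn]]]]]]]].
move=> [at1 bu1 e1] [at2 bu2 e2] uniq_ oo.
have pa : proper_subarc a by apply: lm.1; left.
have pb : proper_subarc b by apply: lm.1; right.
exists a, b; split.
- exact: local_move_push.
- by split; exact: simple_on_push.
- by move=> t u at_ bu /(along_push is' pa pb at_ bu); exact: dis.
exists t1, u1, t2, u2; split=> //.
- by split=> //; apply/(along_push is_ pa pb (op_cl_par at1) (op_cl_par bu1)).
- by split=> //; apply/(along_push is_ pa pb (op_cl_par at2) (op_cl_par bu2)).
- by move=> t u at_ bu /(along_push is_ pa pb at_ bu); exact: uniq_.
Qed.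

Lemma R3_push s o s' o' : inside S s -> inside S s' ->
  R3 S s o s' o' -> R3 T (push_strands f s) o (push_strands f s') o'.
Proof.
move=> is_ is' [a [b [c [lm [sa sb sc] [sa' sb' sc']]]]].
move=> [ab [ba [ac [ca [bc [cb [ab' [ba' [ac' [ca' [bc' [cb']]]]]]]]]]]].
move=> [[x1 x2 x3] [x1' x2' x3'] ord].
have pa : proper_subarc a by apply: lm.1; left; left.
have pb : proper_subarc b by apply: lm.1; left; right.
have pc : proper_subarc c by apply: lm.1; right.
exists a, b, c; split.
- exact: local_move_push.
- by split; exact: simple_on_push.
- by split; exact: simple_on_push.
exists ab, ba, ac, ca, bc, cb, ab', ba', ac', ca', bc', cb'.
by split=> //; split; exact: crosses_over_once_push.
Qed.

End PushEquivalence.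

Section PushClasses.
Context {R : realType} (S T U : set (plane R)) (f g : plane R -> plane R).
Hypotheses (cU : chart U f g) (SU : S° `<=` U) (ST : forall x, S° x -> T° (f x)).

Lemma reidemeister_push D E : is_diagram S D -> is_diagram S E ->
  reidemeister S D E -> reidemeister T (push f D) (push f E).
Proof.
move=> dD dE [n [s [s' [ o [ o' [eD eE mv]]]]]]; subst D E.
have is_ : inside S s by have [[[]]] := dD.
have is' : inside S s' by have [[[]]] := dE.
exists n, (push_strands f s), (push_strands f s'), o, o'; split=> //.
by case: mv => mv; [apply: Or31|apply: Or32|apply: Or33];
  [exact: (R1_push cU SU ST)|exact: (R2_push cU SU ST)|exact: (R3_push cU SU ST)].
Qed.

Lemma equivalent_push D E : equivalent S D E -> equivalent T (push f D) (push f E).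
Proof.
elim=> {D E} [D E [dD dE mv]|D|D E _ IH|D E F _ IH1 _ IH2].
- have dfD := is_diagram_push cU SU ST dD; have dfE := is_diagram_push cU SU ST dE.
  case: mv => [mv|mv|mv].
  + by apply: rst_step; split=> //; apply: Or31; exact: (reparametrization_push cU SU dD).
  (* This case can cost two moves: the conjugated isotopy, then a reparametrization correcting
     values off the source. *)
  + exact: (isotopic_push cU SU ST).
  + by apply: rst_step; split=> //; apply: Or33; exact: reidemeister_push.
- exact: rst_refl.
- exact: rst_sym.
- exact: rst_trans IH1 IH2.
Qed.

End PushClasses.

(** * Shrinking diagrams *)

Section Shrinking.
Context {R : realType}.
Implicit Types (S T : set (plane R)) (D E : @diagram R) (p q v : plane R).

Lemma push_id D : push id D = D.
Proof. by case: D. Qed.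

Lemma is_diagram_mono S T D : S° `<=` T° -> is_diagram S D -> is_diagram T D.
Proof. by move=> ST /(is_diagram_push chart_id (fun _ _ => I) ST); rewrite push_id. Qed.

Lemma equivalent_mono S T D E : S° `<=` T° -> equivalent S D E -> equivalent T D E.
Proof. by move=> ST /(equivalent_push chart_id (fun _ _ => I) ST); rewrite !push_id. Qed.

Definition open_ball p (rho : R) : set (plane R) := [set x | sqnorm (x - p) < rho ^+ 2].

Lemma continuous_sqnorm (x : plane R) : {for x, continuous (@sqnorm R)}.
Proof. by apply: (class_C_continuous (class_C_sqnorm (class_C_id 0 _)) I). Qed.

Lemma open_ball_open p rho : open (open_ball p rho).
Proof.
rewrite (_ : open_ball p rho = (fun x => sqnorm (x - p)) @^-1` [set s | s < rho ^+ 2])//.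
apply: open_comp; last exact: open_lt.
move=> x _; apply: (@class_C_continuous _ 0 _ _ setT) => //; apply: class_C_sqnorm.
exact: (class_CD openT (class_C_id _ _) (class_C_cst _ _ _)).
Qed.

Lemma interior_open_ball p rho : (open_ball p rho)° = open_ball p rho.
Proof. exact/interior_id/open_ball_open. Qed.

Lemma open_ballxx p rho : 0 < rho -> open_ball p rho p.
Proof. by move=> r0; rewrite /open_ball /= subrr /sqnorm /= expr0n addr0 exprn_gt0. Qed.

(** The topology of the plane is that of squares, so a Euclidean ball of radius below [eps] is
    fitted into the square of half-side [eps]. *)
Lemma nbhs_open_ball p (A : set (plane R)) : nbhs p A ->
  exists2 rho, 0 < rho < 1 & open_ball p rho `<=` A.
Proof.
move=> /nbhs_ballP[eps eps0 epsA]; have e0 : 0 < eps by [].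
exists (Num.min (eps / 2) 2^-1).
  by rewrite lt_min divr_gt0//= invr_gt0 ltr0n /= gt_min orbC invf_lt1 ?ltr1n// ltr0n.
move=> x Bx; apply: epsA; move: Bx; rewrite /open_ball /sqnorm /=.
set rho := Num.min _ _ => h.
have r0 : 0 < rho by rewrite lt_min divr_gt0//= invr_gt0 ltr0n.
have re : rho < eps by rewrite gt_min gtr_pMr// invf_lt1 ?ltr1n ?ltr0n.
have lt_sqr (u w : R) : u ^+ 2 + w ^+ 2 < rho ^+ 2 -> `|u| < eps.
  move=> huw; apply: lt_trans re; rewrite -(ltr_pXn2r (n := 2))// ?nnegrE ?ltW//.
  by rewrite real_normK ?num_real// (le_lt_trans _ huw)// lerDl sqr_ge0.
split; rewrite /ball /= distrC.
  exact: lt_sqr h.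
by apply: (lt_sqr _ (x.1 - p.1)); rewrite addrC.
Qed.

(** At an interior point with |x| >= 1, the points t x with t slightly above 1 would still lie in
    the disc, although |t x| > 1. *)
Lemma interior_disc : (@disc R)° = open_ball 0 1.
Proof.
apply/seteqP; split=> x; last first.
  rewrite -interior_open_ball; apply: interiorS => y.
  by rewrite /open_ball /disc /= subr0 expr1n => /ltW.
move=> dx; rewrite /open_ball /= subr0 expr1n ltNge; apply/negP => x1.
have : (fun t : R => t *: x) @ (1 : R)^'+ --> (1 : R) *: x.
  by apply: cvg_at_right_filter; apply: cvgZr_tmp; exact: cvg_id.
rewrite scale1r => /(_ _ dx) hd.
near (1 : R)^'+ => t.
have : disc (t *: x) by near: t; exact: hd.
rewrite /disc /= sqnormZ leNgt => /negP; apply.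
have t1 : 1 < t by near: t; exact: nbhs_right_gt.
by rewrite (lt_le_trans _ (ler_peMr _ x1))// ?sqr_ge0// exprn_egt1.
Unshelve. all: by end_near.
Qed.

Lemma periodic_int (h : R -> plane R) : (forall t, h (t + 1) = h t) ->
  forall t (k : int), h (t + k%:~R) = h t.
Proof.
move=> h1; have hn t (n : nat) : h (t + n%:R) = h t.
  by elim: n => [|n IH]; rewrite ?addr0// -addn1 natrD addrA h1.
by move=> t [n|n]; [exact: hn|rewrite NegzE mulrNz -(hn _ n.+1) subrK].
Qed.

(** Compactness leaves room near the boundary for a radial isotopy: the squared norm attains a
    maximum below 1 on each of the finitely many components. *)
Lemma diagram_bounded D : is_diagram (open_ball 0 1) D ->
  exists2 a : R, 0 <= a < 1 &
    forall p : pt (ncircles D), in_source p -> sqnorm (at_pt (@strand _ D) p) <= a.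
Proof.
case: D => n s o [[[Cs per is_ _] _] _] /=.
have sup c : exists m, m < 1 /\ forall t, dom c t -> sqnorm (s c t) <= m.
  have sub01 : [set t | 0 <= t <= 1] `<=` dom c by case: c => [i|] t.
  have [|t0 t01 mt] := @EVT_max _ (fun t => sqnorm (s c t)) 0 1 ler01.
    apply: continuous_in_subspaceT => t /set_mem /= t01.
    apply: continuous_comp; last exact: continuous_sqnorm.
    apply/differentiable_continuous/(smooth_near_differentiable (Cs c))/sub01.
    by rewrite in_itv in t01.
  exists (sqnorm (s c t0)); split.
    have : in_source (c, t0) by apply: sub01; rewrite in_itv in t01.
    by move=> /is_; rewrite interior_open_ball /open_ball /= subr0 expr1n.
  case: c {sub01} t01 mt => [i|] t01 mt t; last by move=> t01'; apply: mt; rewrite in_itv.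
  (* On a circle the parameter is brought into [0,1] by subtracting its floor. *)
  move=> _; rewrite -[t](subrK (Num.floor t)%:~R) periodic_int; last exact: per.
  apply: mt; rewrite in_itv /= subr_ge0 floor_le_tmp/= lerBlDr addrC.
  by have := floorD1_gt t; rewrite intrD => /ltW.
have [m hm] := choice sup.
exists (\big[Order.max/0]_(c : component n) m c).
  rewrite bigmax_ge_id /=; apply/bigmax_ltP; split=> // c _; exact: (hm c).1.
move=> [c t] ct; apply: le_trans ((hm c).2 t ct) _.
exact: le_bigmax.
Qed.

Definition affine (c : R) v (x : plane R) : plane R := c *: x + v.

Lemma affine_comp c c' v v' :
  affine c v \o affine c' v' = affine (c * c') (c *: v' + v).
Proof. by apply/funext => x; rewrite /affine /= scalerDr scalerA addrA. Qed.

Lemma chart_affine c v : c != 0 -> chart setT (affine c v) (affine c^-1 (- (c^-1 *: v))).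
Proof.
move=> c0; apply: diffeo_chart => [k|k|x|x].
- apply: class_CD openT _ (class_C_cst _ _ _).
  exact: (class_CZ has_coordinates_plane openT (class_C_cst _ _ _) (class_C_id _ _)).
- apply: class_CD openT _ (class_C_cst _ _ _).
  exact: (class_CZ has_coordinates_plane openT (class_C_cst _ _ _) (class_C_id _ _)).
- by rewrite /affine scalerDr scalerA mulVf// scale1r addrK.
- by rewrite /affine scalerDr scalerN !scalerA mulfV// !scale1r subrK.
Qed.

(** The diagram stays in |x|^2 <= a < 1, where the final stage of [radial] is multiplication by [d];
    taking [b] midway between [a] and 1 keeps the support inside the ball. *)
Lemma shrink_unit D d : 0 < d < 1 -> is_diagram (open_ball 0 1) D ->
  equivalent (open_ball 0 1) D (push (affine d 0) D).
Proof.
move=> d01 dD; have /andP[d0 d1] := d01.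
have [a /andP[a0 a1] Da] := diagram_bounded dD.
have ab : a < (a + 1) / 2 by lra.
have iH : surface_isotopy (open_ball 0 1) (radial a ((a + 1) / 2) d).
  apply: radial_isotopy => // x; rewrite interior_open_ball /open_ball /= subr0 expr1n.
  by move=> /le_lt_trans; apply; lra.
have ddD : is_diagram (open_ball 0 1) (push (affine d 0) D).
  have dn0 : d != 0 by rewrite gt_eqF.
  apply: (is_diagram_push (chart_affine 0 dn0)) dD => // x.
  rewrite interior_open_ball /open_ball /affine /= !subr0 addr0 expr1n sqnormZ => x1.
  by rewrite (le_lt_trans _ x1)// ler_piMl ?sqnorm_ge0// exprn_ile1 ?ltW.
case: D dD Da ddD => n s o dD Da ddD.
apply: (equivalent_isotopy iH dD ddD) => p sp.
rewrite /radial factor_left//; last exact: Da.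
by rewrite mul1r subKr /at_pt /= /affine addr0.
Qed.

(** The map is the homothety with centre [p] and ratio [d]. The unit ball case is transported by the
    similarity [A], which takes the unit ball to this one. *)
Lemma shrink_ball p rho d D : 0 < rho -> 0 < d < 1 -> is_diagram (open_ball p rho) D ->
  equivalent (open_ball p rho) D (push (affine d ((1 - d) *: p)) D).
Proof.
move=> r0 d01 dD; have rn0 : rho != 0 by rewrite gt_eqF.
have rn0' : rho^-1 != 0 by rewrite invr_eq0.
pose A := affine rho p; pose A' := affine rho^-1 (- (rho^-1 *: p)).
have cA : chart setT A A' := chart_affine p rn0.
have cA' : chart setT A' A.
  by have := chart_sym cA; have [_ _ _ _ AK] := cA;
     rewrite (_ : A @` setT = setT)//; apply/seteqP; split=> // y _;
     exists (A' y) => //; rewrite /A /A' /affine scalerDr scalerN !scalerA mulfV// !scale1r subrK.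
have A'B x : (open_ball p rho)° x -> (open_ball 0 1)° (A' x).
  rewrite !interior_open_ball /open_ball /= subr0 expr1n /A' /affine -scalerBr sqnormZ.
  by rewrite exprVn => h; rewrite mulrC ltr_pdivrMr ?exprn_gt0// mul1r.
have AB x : (open_ball 0 1)° x -> (open_ball p rho)° (A x).
  rewrite !interior_open_ball /open_ball /= subr0 expr1n /A /affine addrK sqnormZ => h.
  by rewrite gtr_pMr// exprn_gt0.
have /(shrink_unit d01)/(equivalent_push cA (fun _ _ => I) AB) :=
  is_diagram_push cA' (fun _ _ => I) A'B dD.
have -> : push A (push A' D) = push (A \o A') D by [].
have -> : push A (push (affine d 0) (push A' D)) = push (A \o (affine d 0 \o A')) D by [].
have -> : A \o A' = id.
  by apply/funext => x; rewrite /A /A' /= /affine -scalerBr scalerA mulfV// scale1r subrK.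
have -> : A \o (affine d 0 \o A') = affine d ((1 - d) *: p).
  apply/funext => x; rewrite /A /A' /= /affine addr0 -scalerBr !scalerA ?mulrA.
  by rewrite mulrAC mulfV// mul1r scalerBr scalerBl scale1r addrA addrAC.
by rewrite push_id.
Qed.

Lemma shrink_disc D d : 0 < d < 1 -> is_diagram disc D ->
  equivalent disc D (push (affine d 0) D).
Proof.
move=> d01 dD; apply: (@equivalent_mono (open_ball 0 1)).
  by rewrite interior_open_ball interior_disc.
apply: shrink_unit d01 _; apply: is_diagram_mono dD.
by rewrite interior_open_ball interior_disc.
Qed.

End Shrinking.

(** * The disc and the annulus *)

Section Classes.
Context {R : realType}.

Lemma equivalent_class S (D E : @diagram R) :
  equivalent S D E -> multi_knotoid S D = multi_knotoid S E.
Proof.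
move=> DE; apply/seteqP; split=> F h; last exact: (@rst_trans _ _ _ _ _ DE h).
exact: (@rst_trans _ _ _ _ _ (@rst_sym _ _ _ _ DE) h).
Qed.

Lemma class_equivalent S (D E : @diagram R) :
  multi_knotoid S D = multi_knotoid S E -> equivalent S D E.
Proof. by move=> DE; have : multi_knotoid S E E by [exact: rst_refl]; rewrite -DE. Qed.

(** The union over representatives collapses to one class, since pushes of equivalent diagrams are
    equivalent. *)
Lemma induced_map_class S T U (f g : plane R -> plane R) D :
  chart U f g -> S° `<=` U -> (forall x, S° x -> T° (f x)) ->
  induced_map T f (multi_knotoid S D) = multi_knotoid T (push f D).
Proof.
move=> cU SU ST; apply/seteqP; split=> [E [D' DD' D'E]|E DE].
  exact: (@rst_trans _ _ _ _ _ (equivalent_push cU SU ST DD') D'E).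
by exists D => //; exact: rst_refl.
Qed.

Lemma induced_map_fun S T U (f g : plane R -> plane R) :
  chart U f g -> S° `<=` U -> (forall x, S° x -> T° (f x)) ->
  set_fun (multi_knotoids S) (multi_knotoids T) (induced_map T f).
Proof.
move=> cU SU ST _ [D dD <-]; rewrite (induced_map_class _ cU SU ST).
by exists (push f D) => //; exact: (is_diagram_push cU SU ST).
Qed.

Lemma sqnorm_sub_lt4 (x y : plane R) : open_ball 0 1 x -> open_ball 0 1 y ->
  sqnorm (x - y) < 4.
Proof.
rewrite /open_ball /= !subr0 expr1n /sqnorm /=.
have := sqr_ge0 (x.1 + y.1); have := sqr_ge0 (x.2 + y.2); lra.
Qed.

Lemma equivalent_push_disc_inj U (e g : plane R -> plane R) (D E : @diagram R) :
  chart U e g -> disc `<=` U -> (forall x, disc° x -> disc° (e x)) ->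
  is_diagram disc D -> is_diagram disc E ->
  equivalent disc (push e D) (push e E) -> equivalent disc D E.
Proof.
move=> cU dU ee dD dE DE.
have [oU _ Ce _ ge] := cU.
have dU' : disc° `<=` U by move=> x /interior_subset /dU.
have d0 : (@disc R)° 0 by rewrite interior_disc; apply: open_ballxx.
have [_ oed _ _ _] := chart_restrict cU (open_interior disc) dU'.
have [rho /andP[r0 r1] Bed] : exists2 rho, 0 < rho < 1 &
    open_ball (e 0) rho `<=` e @` disc°.
  by apply: nbhs_open_ball; apply: open_nbhs_nbhs; split=> //; exists 0.
(* The homothety [c] has centre [e 0] and ratio [rho / 4]; points of the open unit disc are at
   distance below 2 from [e 0], hence land in [B]. *)
pose B := open_ball (e 0) rho; pose d := rho / 4.
pose c := affine d ((1 - d) *: e 0).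
have d01 : 0 < d < 1 by rewrite /d; lra.
have dn0 : d != 0 by rewrite gt_eqF//; lra.
have cc := chart_affine ((1 - d) *: e 0) dn0.
have cB x : disc° x -> B (c x).
  move=> dx; have := ee 0 d0; move: dx; rewrite interior_disc => dx de.
  rewrite /B /open_ball /c /= /affine scalerBl scale1r addrA addrAC addrK -scalerBr sqnormZ.
  by have := sqnorm_sub_lt4 dx de; rewrite /d; nra.
have BU : B `<=` e @` U by move=> y /Bed [x /dU' Ux <-]; exists x.
have Cc : smooth_on setT c by have [] := cc.
have oW : open (c @^-1` B).
  by rewrite -[_ @^-1` _]setTI; apply: open_preimage_on => //;
    [exact: openT|exact: open_ball_open].
have cW := chart_restrict cc oW (fun _ _ => I).
(* The inverse [g] is controlled only on the image of [U], so [g \o c] is a chart on the preimage of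
   [B]. *)
have cM := chart_comp cW (chart_sym cU) (fun y '(ex_intro2 x Bx xy) => BU _ (eq_ind _ B Bx _ xy)).
have gB x : B° x -> disc° (g x).
  by rewrite interior_open_ball => /Bed [y dy <-]; rewrite ge//; exact: dU'.
have Md x : disc° x -> disc° ((g \o c) x).
  by move=> /cB Bx; apply: gB; rewrite interior_open_ball.
have [eps0 /andP[e0 e1] Beps] : exists2 eps0, 0 < eps0 < 1 &
    open_ball 0 eps0 `<=` U `&` e @^-1` B.
  apply: nbhs_open_ball; apply: open_nbhs_nbhs; split; last first.
    by split; [exact: dU'|exact: open_ballxx].
  by apply: open_preimage_on => //; exact: open_ball_open.
have e01 : 0 < eps0 < 1 by rewrite e0 e1.
have en0 : eps0 != 0 by rewrite gt_eqF.
have epsB x : disc° x -> (U `&` e @^-1` B) (affine eps0 0 x).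
  rewrite interior_disc /open_ball /= subr0 expr1n => x1; apply: Beps.
  by rewrite /open_ball /affine /= addr0 subr0 sqnormZ gtr_pMr// exprn_gt0.
have epsd x : disc° x -> disc° (affine eps0 0 x).
  rewrite !interior_disc /open_ball /affine /= !subr0 addr0 expr1n sqnormZ => x1.
  by rewrite (le_lt_trans _ x1)// ler_piMl ?sqnorm_ge0// exprn_ile1 ?ltW.
have back F : is_diagram disc F ->
    equivalent disc F (push (g \o c) (push e (push (affine eps0 0) F))).
  move=> dF; apply: rst_trans (shrink_disc e01 dF) _.
  have dF1 := is_diagram_push (chart_affine 0 en0) (fun _ _ => I) epsd dF.
  have oUB : open (U `&` e @^-1` B) by apply: open_preimage_on => //; exact: open_ball_open.
  have caff := chart_affine 0 en0; have [_ _ Caff _ _] := caff.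
  have ceps := chart_restrict caff (open_preimage_on openT oUB Caff) (fun _ _ => I).
  have ceps' := chart_comp ceps cU (fun y '(ex_intro2 x Bx xy) => eq_ind _ U Bx.2.1 _ xy).
  have dF2 : is_diagram B (push (e \o affine eps0 0) F).
    apply: (is_diagram_push ceps') dF => x dx.
      by split=> //; exact: epsB.
    by rewrite interior_open_ball; exact: (epsB x dx).2.
  have BU' : B° `<=` e @` U by rewrite interior_open_ball.
  have := equivalent_push (chart_sym cU) BU' gB (shrink_ball r0 d01 dF2).
  apply: rst_trans.
  have dF3 := is_diagram_push (chart_sym cU) BU' gB dF2.
  (* The map [g] undoes [e] only on [U]; the two diagrams agree on the source but possibly not
     elsewhere, hence a reparametrization. *)
  apply: rst_step; split=> //; apply: Or31.
  case: F dF {dF1 dF2 dF3} => n s o [[[_ _ is_ _] _] _].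
  apply: reparametrization_source => p sp.
  by apply: ge; exact: (epsB _ (is_ p sp)).1.
have Me := equivalent_push cM cB Md.
have ep := equivalent_push cU dU' ee.
(* With F' the shrinking of F by [eps0] and M = [g \o c], the chain is D ~ M e D' ~ M e E' ~ E. The
   middle link is M applied to e D' ~ e D ~ e E ~ e E'. *)
apply: rst_trans (back D dD) _; apply: rst_trans (rst_sym _ _ _ _ (back E dE)).
apply: Me; apply: rst_trans (rst_sym _ _ _ _ (ep _ _ (shrink_disc e01 dD))) _.
exact: rst_trans DE (ep _ _ (shrink_disc e01 dE)).
Qed.

Lemma annulus_sub_disc (r : R) : (annulus r)° `<=` (@disc R)°.
Proof. by apply: interiorS => x /andP[]. Qed.

(** The witness is a small copy of [D] about a point [p] of the annulus. It lies in a ball about [c]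
    inside the disc, where a homothety about [c] slides it over to a copy centred at 0, and that is
    a shrinking of [D]. *)
Lemma equivalent_annulus (r : R) (D : @diagram R) : 0 < r < 1 -> is_diagram disc D ->
  exists2 E, is_diagram (annulus r) E & equivalent disc D E.
Proof.
move=> /andP[r0 r1] dD.
(* Here [q] is the mid radius and [eta] half of the half-width, so the copy fits. The value of [b]
   makes [q + b + eta = 1 - b]: the copy just fits in the ball of radius [1 - b] about [c]. The
   ratio [d] solves [d * q = (1 - d) * b]. *)
pose q := (1 + r) / 2; pose eta := (1 - r) / 4; pose b := (1 - r) / 8.
pose d := b / (q + b).
have q0 : 0 < q by rewrite /q; lra.
have b0 : 0 < b by rewrite /b; lra.
have eta0 : 0 < eta by rewrite /eta; lra.
have qb : 0 < q + b by rewrite addr_gt0.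
have dqb : d * (q + b) = b by rewrite /d divfK// gt_eqF.
have d01 : 0 < d < 1 by rewrite divr_gt0//= ltr_pdivrMr//; lra.
have etan0 : eta != 0 by rewrite gt_eqF.
(* The contraction about [c] by [d] takes the point [p] of the annulus to [0]. *)
pose p : plane R := (q, 0); pose c : plane R := (- b, 0).
have pin x : (@disc R)° x -> open_ball c (1 - b) (affine eta p x).
  rewrite interior_disc /open_ball /affine /sqnorm /= !subr0 expr1n.
  case: x => u v /=; rewrite /GRing.scale /=.
  move=> h; have u1 : u < 1 by nra.
  have -> : 1 - b = q + b + eta by rewrite /b /q /eta; lra.
  have := mulr_gt0 (mulr_gt0 qb eta0) (_ : 0 < 1 - u); rewrite subr_gt0 => /(_ u1).
  have := mulr_gt0 (mulr_gt0 eta0 eta0) (_ : 0 < 1 - (u ^+ 2 + v ^+ 2)).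
  by rewrite subr_gt0 => /(_ h); lra.
have pa x : (@disc R)° x -> (annulus r)° (affine eta p x).
  move=> dx; have oA : open [set y : plane R | r ^+ 2 < sqnorm y < 1].
    have cs y : {for y, continuous (@sqnorm R)} by exact: continuous_sqnorm.
    rewrite (_ : [set _ | _] = sqnorm @^-1` [set s : R | r ^+ 2 < s] `&`
      sqnorm @^-1` [set s : R | s < 1]).
      by apply: openI; (apply: open_comp; first by move=> y _; exact: cs);
        [exact: open_gt|exact: open_lt].
    by apply/seteqP; split=> y /= => [/andP[]|[-> ->]].
  have : [set y : plane R | r ^+ 2 < sqnorm y < 1] (affine eta p x).
    move: (dx) (pin x dx); rewrite interior_disc /open_ball /affine /sqnorm /= !subr0 expr1n.
    case: x {dx} => u v /=; rewrite /GRing.scale /= => h1 h2.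
    (* The inner bound uses only the first coordinate, which exceeds q - eta > r. For the outer one,
       membership in the ball about [c] gives |y|^2 < 1 - 2 b (1 + y_1) for the image point y. *)
    have u1 : 0 < 1 + u by nra.
    have h3 := mulr_gt0 eta0 u1; rewrite {1}/eta in h3.
    have h4 : r < eta * u + q by rewrite /q /eta; lra.
    have h5 : 0 < b * (eta * u + q) by apply: mulr_gt0 => //; lra.
    have h6 : 0 <= (eta * v + 0) ^+ 2 := sqr_ge0 _.
    apply/andP; split; last by lra.
    by rewrite ltr_wpDr// ltr_pXn2r// nnegrE ltW// (lt_trans r0).
  move=> /(conj oA)/open_nbhs_nbhs; apply: filterS => y /andP[h1 h2].
  by rewrite /annulus /= !ltW.
have cp := chart_affine p etan0.
exists (push (affine eta p) D); first exact: (is_diagram_push cp (fun _ _ => I) pa).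
have b1 : 0 < 1 - b by rewrite /b; lra.
have dB : is_diagram (open_ball c (1 - b)) (push (affine eta p) D).
  by apply: (is_diagram_push cp (fun _ _ => I)) dD => x /pin; rewrite interior_open_ball.
(* This ball touches the unit circle from inside at (-1, 0); its inequality reads x^2 + y^2 < 1 - 2
   b (1 + x), and x > -1. *)
have BD : (open_ball c (1 - b))° `<=` (@disc R)°.
  rewrite interior_open_ball interior_disc => -[x y].
  rewrite /open_ball /sqnorm /= !subr0 expr1n opprK => h.
  have : - 1 < x by nra.
  nra.
have := equivalent_mono BD (shrink_ball b1 d01 dB).
have -> : push (affine d ((1 - d) *: c)) (push (affine eta p) D) =
    push (affine d ((1 - d) *: c) \o affine eta p) D by [].
(* By the choice of [d] the translation part [d *: p + (1 - d) *: c] vanishes, leaving the central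
   shrinking by [d * eta]. *)
rewrite affine_comp (_ : _ + _ = 0).
  move=> h; apply: (@rst_trans _ _ _ _ _ _ (@rst_sym _ _ _ _ h)); apply: shrink_disc dD.
  by have /andP[? ?] := d01; rewrite mulr_gt0//= /eta; nra.
rewrite /c /p; congr (_, _); rewrite /= /GRing.scale /= ?mulr0 ?addr0//; lra.
Qed.

End Classes.

Unset Implicit Arguments.

Theorem proposition2p6 (R : realType) (r : R) (e : plane R -> plane R)
    (hr : 0 < r < 1) (he : embedding disc e)
    (heA : e @` disc `<=` (annulus r)°) :
  let iota := induced_map (annulus r) e in
  let rho := induced_map disc id in
  [/\ set_fun (multi_knotoids disc) (multi_knotoids (annulus r)) iota,
      (forall D, is_diagram disc D ->
         iota (multi_knotoid disc D) = multi_knotoid (annulus r) (push e D)) &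
      set_inj (multi_knotoids disc) iota] /\
  [/\ set_fun (multi_knotoids (annulus r)) (multi_knotoids disc) rho,
      (forall D, is_diagram (annulus r) D ->
         rho (multi_knotoid (annulus r) D) = multi_knotoid disc (push id D)) &
      set_surj (multi_knotoids (annulus r)) (multi_knotoids disc) rho].
Proof.
move=> iota rho.
have [U [g [[oU dU] oeU Ce Cg ge]]] := he.
have cU : chart U e g by split.
have dU' : disc° `<=` U by move=> x /interior_subset /dU.
have eA x : disc° x -> (annulus r)° (e x).
  by move=> /interior_subset dx; apply: heA; exists x.
have AD : forall x, (annulus r)° x -> (@disc R)° (id x) by exact: annulus_sub_disc.
have iotaE D : iota (multi_knotoid disc D) = multi_knotoid (annulus r) (push e D).
  exact: (induced_map_class _ cU dU' eA).
have rhoE D : rho (multi_knotoid (annulus r) D) = multi_knotoid disc (push id D).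
  exact: (induced_map_class _ chart_id (fun _ _ => I) AD).
split; split=> //.
- exact: (induced_map_fun cU dU' eA).
- move=> _ _ /set_mem [D dD <-] /set_mem [E dE <-]; rewrite !iotaE.
  move=> /class_equivalent /(equivalent_mono (@annulus_sub_disc R r)) DE.
  apply: equivalent_class; apply: (equivalent_push_disc_inj cU dU _ dD dE DE).
  by move=> x /eA /annulus_sub_disc.
- exact: (induced_map_fun chart_id (fun _ _ => I) AD).
- move=> _ [D dD <-]; have [E dE DE] := equivalent_annulus hr dD.
  exists (multi_knotoid (annulus r) E); first by exists E.
  by rewrite rhoE push_id; symmetry; exact: equivalent_class.
Qed.
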